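(* Let $G$ be a Lie group with Lie algebra $\mathfrak{g}$ and let $(M,\omega,\mathtt{a},\mu)$ be the data defining a Hamiltonian action of $G$. Then $(G\ltimes_{\mathtt{a}}M\rightrightarrows M,\ \mathrm{id}\times\mu,\ \omega)$ is a shifted Lagrangian structure for the $1$-shifted symplectic groupoid $(T^*G\rightrightarrows\mathfrak{g}^*,\omega_{\mathrm{can}})$; that is, $\omega$ is a shifted Lagrangian structure on the Lie groupoid morphism $\mathrm{id}\times\mu:G\ltimes_{\mathtt{a}}M\to G\ltimes\mathfrak{g}^*=T^*G$.
   Context: Hamiltonian action: $(M,\omega)$ is a symplectic manifold, $\mathtt{a}:G\times M\to M$ a smooth action and $\mu:M\to\mathfrak{g}^*$ a smooth map with (1) $\mathtt{a}_g^*\omega=\omega$ for all $g\in G$; (2) $\langle d\mu,X\rangle=-\iota_{\rho(X)}\omega$ for $X\in\mathfrak{g}$, where $\rho(X)_p=\frac{d}{dt}|_{t=0}\mathtt{a}(\exp(tX),p)$ is the generating vector field; (3) $\mu\circ\mathtt{a}_g=Ad_g^*\circ\mu$, where $\langle Ad_g^*\xi,X\rangle=\langle\xi,Ad_{g^{-1}}X\rangle$ is the coadjoint action. Groupoids: for an action of $G$ on $N$, the action groupoid $G\ltimes N\rightrightarrows N$ has source $\mathtt{s}(g,p)=p$, target $\mathtt{t}(g,p)=g\cdot p$ and unit $1_p=(e,p)$. $T^*G\cong G\times\mathfrak{g}^*$ (left trivialization) is the action groupoid $G\ltimes\mathfrak{g}^*\rightrightarrows\mathfrak{g}^*$ of the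 coadjoint action, with symplectic form $\omega_{\mathrm{can}}=-d\theta$, where $\theta=\langle\xi,\theta^l\rangle$ at $(g,\xi)$ is the tautological $1$-form and $\theta^l$ is the left Maurer–Cartan form on $G$; it is a $1$-shifted symplectic Lie groupoid. Shifted Lagrangian structures in this case ($m=n=1$): for a Lie groupoid $J\rightrightarrows X$ put $\delta\eta=\mathtt{s}^*\eta-\mathtt{t}^*\eta$ for $\eta\in\Omega^\bullet(X)$, let $A_J=\ker T\mathtt{s}|_X$, and let the tangent complex be $A_J\xrightarrow{\partial}TX$ in degrees $-1,0$ with $\partial=-T\mathtt{t}$. Let $(K\rightrightarrows N,\Omega)$ be a symplectic groupoid (viewed as $1$-shifted symplectic with zero $3$-form) and $\Phi:J\to K$ a Lie groupoid morphism covering $\Phi_0:X\to N$. An isotropic structure on $\Phi$ is $\eta\in\Omega^2(X)$ with $\Phi^*\Omega=\delta\eta$ and $d\eta=0$ (i.e. $\Phi^*\Omega=D\eta$ with $D\eta=\delta\eta+d\eta$). It is a shifted Lagrangian structure if at every $x\in X$ the following cochain map is a quasi-isomorphism: from the normal complex $$A_{J,x}\xrightarrow{a\mapsto(\partial a,\,T\Phi a)}T_xX\oplus A_{K,\Phi_0(x)}\xrightarrow{(v,w)\mapsto T\Phi_0v-\partial w}T_{\Phi_0(x)}N$$ (in degrees $-1,0,1$) to the complex $0\to T_x^*X\xrightarrow{-\partial^t}A_{J,x}^*$ (in degrees $-1,0,1$), given in degree $0$ by $(v,w)\mapsto-\eta(v,\cdot)+\Omega(w,T1\circ T\Phi_0(\cdot))$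 and in degree $1$ by $u\mapsto\Omega(T1(u),T\Phi(\cdot))$, where $T1$ is the differential of the unit map of $K$. *)

(* Defs.v *)
Set Warnings "-notation-overridden,-ambiguous-paths,-notation-incompatible-prefix,-redundant-canonical-projection".
From HB Require Import structures.
From mathcomp Require Import all_boot all_order all_algebra.
From mathcomp Require Import all_classical all_reals all_analysis.
Import Order.TTheory GRing.Theory Num.Theory.
Import numFieldNormedType.Exports.
Set Implicit Arguments. Unset Strict Implicit. Unset Printing Implicit Defensive.
Local Open Scope classical_set_scope.
Local Open Scope ring_scope.
(* Finite-dimensional normed spaces: the model spaces of manifolds. *)
#[short(type="normedVectType")]
HB.structure Definition NormedVector (R : numFieldType) := {E of NormedModule R E & Vector R E}.
HB.instance Definition _ (R : realType) m n := Vector.on 'M[R]_(m, n).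
HB.instance Definition _ (R : realType) := Vector.on R^o.
HB.instance Definition _ (R : realType) (E F : normedVectType R) := Vector.on (E * F)%type.

Section Topology.

Lemma second_countable_dense (R : realType) (V : normedModType R) (D : set V) :
  countable D -> dense D -> @second_countable V.
Proof.
move=> cD dD.
exists [set ball dk.1 (dk.2.+1%:R^-1 : R) | dk in D `*` [set: nat]].
  by apply: sub_countable (card_image_le _ _) _; exact: countableX.
split; first by move=> _ [[d k] _ <-]; exact: ball_open.
move=> x A /nbhs_ballP[e /= e0 xA].
have [k ke] : exists k : nat, (k.+1%:R^-1 : R) < e / 2.
  have e20 : 0 < e / 2 by rewrite divr_gt0.
  by have [k _ /(_ k (leqnn _))] := near_infty_natSinv_lt (PosNum e20); exists k.
have k0 : 0 < (k.+1%:R^-1 : R) by rewrite invr_gt0.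
have [d [xd Dd]] : ball x (k.+1%:R^-1 : R) `&` D !=set0.
  by apply: dD; [exists x; exact: ballxx|exact: ball_open].
exists (ball d (k.+1%:R^-1 : R)); last first.
  move=> y dy; apply: xA; rewrite [e]splitr.
  by apply: ball_triangle; [apply: (le_ball (ltW ke) xd)|apply: (le_ball (ltW ke) dy)].
by split; [exists (d, k) => //|exact: ball_sym].
Qed.

Lemma second_countable_mx (R : realType) m n : @second_countable 'M[R]_(m, n).
Proof.
apply: (@second_countable_dense _ _ (range (fun q : 'M[rat]_(m, n) => map_mx (@ratr R) q))).
  exact: sub_countable (card_image_le _ _) (countableP _).
move=> O [M OM] oO; have /nbhs_ballP[e /= e0 MO] : nbhs M O by exact: open_nbhs_nbhs.
have /choice[q qM] : forall ij : 'I_m * 'I_n, exists q : rat,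
    ball (M ij.1 ij.2) e (ratr q : R).
  move=> [i j] /=.
  have [|r [Br [q _ qr]]] := @dense_rat R _ _ (ball_open (M i j : R^o) e).
    by exists (M i j); exact: ballxx.
  by exists q; rewrite qr.
exists (map_mx ratr (\matrix_(i, j) q (i, j))); split; last by exists (\matrix_(i, j) q (i, j)).
by apply: MO; split=> // i j; rewrite !mxE; exact: (qM (i, j)).
Qed.

Lemma second_countable_real (R : realType) : @second_countable R^o.
Proof.
apply: (@second_countable_dense _ R^o (range (@ratr R))).
  exact: sub_countable (card_image_le _ _) (countableP _).
exact: dense_rat.
Qed.

Lemma second_countable_prod (S T : topologicalType) :
  @second_countable S -> @second_countable T -> @second_countable (S * T)%type.
Proof.
move=> [A cA [oA bA]] [B cB [oB bB]].
exists [set UV.1 `*` UV.2 | UV in A `*` B].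
  by apply: sub_countable (card_image_le _ _) _; exact: countableX.
split.
  move=> _ [[U V] [/= AU BV] <-]; rewrite openE => -[x y] [/= Ux Vy].
  by exists (U, V) => //; split; apply: open_nbhs_nbhs; split=> //; [exact: oA|exact: oB].
move=> [x y] O [[U V] [/= Ux Vy] UVO].
have [U' [AU' U'x] sU] := bA x U Ux; have [V' [BV' V'y] sV] := bB y V Vy.
exists (U' `*` V'); last by move=> z [/sU Uz /sV Vz]; apply: UVO.
by split=> //; exists (U', V').
Qed.

Lemma hausdorff_prod (S T : topologicalType) :
  hausdorff_space S -> hausdorff_space T -> hausdorff_space (S * T)%type.
Proof.
move=> hS hT [x y] [x' y'] cl; congr pair.
  apply: hS => A B Ax Bx.
  have [||[a b] [/= Aa Ba]] := cl (A `*` setT) (B `*` setT); last by exists a; case: Aa; case: Ba.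
  - by exists (A, setT) => //; split=> //; exact: filterT.
  - by exists (B, setT) => //; split=> //; exact: filterT.
apply: hT => A B Ay By.
have [||[a b] [/= Ab Bb]] := cl (setT `*` A) (setT `*` B); last by exists b; case: Ab; case: Bb.
- by exists (setT, A) => //; split=> //; exact: filterT.
- by exists (setT, B) => //; split=> //; exact: filterT.
Qed.

Lemma open_setX (S T : topologicalType) (A : set S) (B : set T) :
  open A -> open B -> open (A `*` B).
Proof.
rewrite !openE => oA oB [x y] [/= Ax By].
by exists (A, B) => //; split; [exact: oA|exact: oB].
Qed.

End Topology.

Section Smooth.
Variable R : realType.

(* [U] is meant to be open. In finite dimension, continuity of all iterated
   directional derivatives is the usual C^k condition. *)
Fixpoint Ck_on (E F : normedVectType R) (k : nat) (U : set E) (f : E -> F) : Prop :=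
  match k with
  | 0%N => forall x, U x -> {for x, continuous f}
  | k'.+1 => (forall x, U x -> differentiable f x) /\
             forall v : E, Ck_on k' U (fun x => 'D_v f x)
  end.

Definition smooth_on (E F : normedVectType R) (U : set E) (f : E -> F) :=
  forall k, Ck_on k U f.

Lemma near_eq_differentiable (E F : normedModType R) (f g : E -> F) (x : E) :
  (\near x, f x = g x) -> differentiable f x -> differentiable g x.
Proof.
move=> fg df; have [cdf /eqaddoP fE] := (diff_locallyP _ _).1 df.
have fgx : f x = g x by exact: nbhs_singleton fg.
have gE : g \o shift x = cst (g x) + 'd f x +o_ 0 id.
  apply/eqaddoP => e e0; have := fE e e0.
  have : \forall y \near 0, f (y + x) = g (y + x).
    by move: fg; rewrite (near_shift 0 x) subr0.
  apply: filterS2 => y /=.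
  by rewrite !fctE /= fgx => ->.
by apply/diff_locallyP; rewrite (diff_unique cdf gE).
Qed.

Lemma Ck_on_eq (E F : normedVectType R) k (U : set E) (f g : E -> F) :
  open U -> {in U, f =1 g} -> Ck_on k U f -> Ck_on k U g.
Proof.
move=> oU; elim: k f g => [|k IH] f g fg /=.
  move=> cf x Ux; rewrite /prop_for /continuous_at -fg ?inE//.
  apply: cvg_trans (cf x Ux); apply: near_eq_cvg.
  by near=> y; rewrite fg// inE; near: y; exact: open_nbhs_nbhs.
have nfg x : U x -> \near x, f x = g x.
  by move=> Ux; near=> y; apply: fg; rewrite inE; near: y; exact: open_nbhs_nbhs.
move=> [df dDf]; split=> [x Ux|v].
  exact: near_eq_differentiable (nfg _ Ux) (df x Ux).
apply: IH (dDf v) => x; rewrite inE => Ux.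
exact: near_eq_derive (nfg x Ux).
Unshelve. all: by end_near. Qed.

Lemma smooth_on_prod (E F E' F' : normedVectType R) (U : set E) (V : set F)
    (f : E -> E') (g : F -> F') : open U -> open V ->
  smooth_on U f -> smooth_on V g ->
  smooth_on (U `*` V) (fun z : E * F => (f z.1, g z.2) : (E' * F')%type).
Proof.
move=> oU oV + + k; elim: k f g => [|k IH] f g sf sg /=.
  move=> [x y] [/= Ux Vy]; apply: cvg_pair => /=.
    by apply: (cvg_comp _ _ cvg_fst); exact: (sf 0%N).
  by apply: (cvg_comp _ _ cvg_snd); exact: (sg 0%N).
have dfst z : is_diff z (fst : E * F -> E) fst.
  apply: DiffDef; last by rewrite diff_lin//; move=> ?; exact: cvg_fst.
  by apply: linear_differentiable => ?; exact: cvg_fst.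
have dsnd z : is_diff z (snd : E * F -> F) snd.
  apply: DiffDef; last by rewrite diff_lin//; move=> ?; exact: cvg_snd.
  by apply: linear_differentiable => ?; exact: cvg_snd.
have dfg z : (U `*` V) z ->
    is_diff z (fun z : E * F => (f z.1, g z.2) : (E' * F')%type)
      (fun v : E * F => ('d f (z.1) v.1, 'd g (z.2) v.2)).
  case: z => x y [/= Ux Vy].
  have /differentiableP dfx := (sf 1%N).1 _ Ux.
  have /differentiableP dgy := (sg 1%N).1 _ Vy.
  have df : is_diff (x, y) (f \o (fst : E * F -> E)) ('d f x \o fst) by exact: is_diff_comp.
  have dg : is_diff (x, y) (g \o (snd : E * F -> F)) ('d g y \o snd) by exact: is_diff_comp.
  exact: is_diff_pair.
split=> [z UVz|v]; first by have [] := dfg z UVz.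
apply: (@Ck_on_eq _ _ _ _
    (fun z : E * F => (derive f z.1 v.1, derive g z.2 v.2) : (E' * F')%type)).
- exact: open_setX.
- move=> z; rewrite inE => UVz; have [dz vz] := dfg z UVz; have [Uz Vz] := UVz.
  rewrite [RHS]deriveE// vz !deriveE//; first exact: (sg 1%N).1.
  exact: (sf 1%N).1.
- by apply: (IH (fun x => derive f x v.1) (fun y => derive g y v.2)) => j;
    [exact: (sf j.+1).2|exact: (sg j.+1).2].
Qed.

Lemma Ck_on_cst (E F : normedVectType R) k (U : set E) (c : F) :
  Ck_on k U (cst c : E -> F).
Proof.
elim: k c => [|k IH] c /=; first by move=> x _; exact: cst_continuous.
split=> // v; rewrite (_ : (fun x => _) = cst 0); first exact: IH.
by apply/funext => x; rewrite derive_cst.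
Qed.

Lemma smooth_on_id (E : normedVectType R) (U : set E) : smooth_on U (@id E).
Proof.
case=> [|k] /=; first by move=> x _; exact: cvg_id.
split=> // v; rewrite (_ : (fun x => _) = cst v); first exact: Ck_on_cst.
by apply/funext => x; rewrite derive_id.
Qed.

End Smooth.

#[local] Obligation Tactic := idtac.

Section Manifold.
Variable R : realType.

(* A homeomorphism between the open sets [csource] and [ctarget]; the values of
   [cto] and [cfrom] outside of them are irrelevant. *)
Record chart (M : topologicalType) (E : normedVectType R) := Chart {
  csource : set M;
  ctarget : set E;
  cto :> M -> E;
  cfrom : E -> M;
  csource_open : open csource;
  ctarget_open : open ctarget;
  cto_target : forall p, csource p -> ctarget (cto p);
  cfrom_source : forall x, ctarget x -> csource (cfrom x);
  ctoK : forall p, csource p -> cfrom (cto p) = p;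
  cfromK : forall x, ctarget x -> cto (cfrom x) = x;
  cto_continuous : forall p, csource p -> {for p, continuous cto};
  cfrom_continuous : forall x, ctarget x -> {for x, continuous cfrom} }.

(* [chart_at] selects a preferred chart around every point. The tangent space
   T_pM is identified with the model space E by means of the differential of
   [chart_at p] at p; hence tangent vectors, at every point, have type E. *)
Record manifold (E : normedVectType R) := Manifold {
  carrier :> topologicalType;
  atlas : set (chart carrier E);
  chart_at : carrier -> chart carrier E;
  chart_at_atlas : forall p, atlas (chart_at p);
  chart_at_source : forall p, csource (chart_at p) p;
  transition_smooth : forall c d, atlas c -> atlas d ->
    smooth_on (ctarget c `&` cfrom c @^-1` csource d) (d \o cfrom c);
  manifold_hausdorff : hausdorff_space carrier;
  manifold_second_countable : @second_countable carrier }.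

Definition smooth (E F : normedVectType R) (M : manifold E) (N : manifold F)
    (f : M -> N) :=
  continuous f /\
  forall c d, atlas c -> atlas d ->
    smooth_on (ctarget c `&` (f \o cfrom c) @^-1` csource d) (d \o f \o cfrom c).

(* T_p f : T_pM -> T_(f p)N, read in the preferred charts at p and f p. *)
Definition tmap (E F : normedVectType R) (M : manifold E) (N : manifold F)
    (f : M -> N) (p : M) : 'Hom(E, F) :=
  linfun ('d (chart_at (f p) \o f \o cfrom (chart_at p)) (chart_at p p)).

Section VectorManifold.
Variables (E : normedVectType R) (E_sc : @second_countable E).

Program Definition id_chart : chart E E :=
  @Chart E E setT setT id id _ _ _ _ _ _ _ _.
Next Obligation. exact: openT. Qed.
Next Obligation. exact: openT. Qed.
Next Obligation. by []. Qed.
Next Obligation. by []. Qed.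
Next Obligation. by []. Qed.
Next Obligation. by []. Qed.
Next Obligation. by move=> p _; exact: cvg_id. Qed.
Next Obligation. by move=> p _; exact: cvg_id. Qed.

Program Definition vector_manifold : manifold E :=
  @Manifold E E [set id_chart] (fun=> id_chart) _ _ _ _ E_sc.
Next Obligation. by []. Qed.
Next Obligation. by []. Qed.
Next Obligation. by move=> c d -> ->; exact: smooth_on_id. Qed.
Next Obligation. exact: norm_hausdorff. Qed.

End VectorManifold.

Section ProductManifold.
Variables (E F : normedVectType R).

Program Definition prod_chart (M N : topologicalType) (c : chart M E)
    (d : chart N F) : chart (M * N)%type (E * F)%type :=
  @Chart (M * N)%type (E * F)%type (csource c `*` csource d)
    (ctarget c `*` ctarget d)
    (fun z => (c z.1, d z.2)) (fun z => (cfrom c z.1, cfrom d z.2))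
    _ _ _ _ _ _ _ _.
Next Obligation. by move=> *; apply: open_setX; exact: csource_open. Qed.
Next Obligation. by move=> *; apply: open_setX; exact: ctarget_open. Qed.
Next Obligation. by move=> M N c d p [*]; split; exact: cto_target. Qed.
Next Obligation. by move=> M N c d p [*]; split; exact: cfrom_source. Qed.
Next Obligation. by move=> M N c d [p q] [*] /=; rewrite !ctoK. Qed.
Next Obligation. by move=> M N c d [p q] [*] /=; rewrite !cfromK. Qed.
Next Obligation.
move=> M N c d [p q] [/= cp dq]; apply: cvg_pair => /=.
  by apply: (cvg_comp _ _ cvg_fst); exact: cto_continuous.
by apply: (cvg_comp _ _ cvg_snd); exact: cto_continuous.
Qed.
Next Obligation.
move=> M N c d [p q] [/= cp dq]; apply: cvg_pair => /=.
  by apply: (cvg_comp _ _ cvg_fst); exact: cfrom_continuous.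
by apply: (cvg_comp _ _ cvg_snd); exact: cfrom_continuous.
Qed.

Lemma open_transition (M : topologicalType) (c d : chart M E) :
  open (ctarget c `&` cfrom c @^-1` csource d).
Proof.
rewrite openE => x [cx dx]; apply: filterI.
  by apply: open_nbhs_nbhs; split => //; exact: ctarget_open.
apply: (cfrom_continuous cx); apply: open_nbhs_nbhs; split => //.
exact: csource_open.
Qed.

End ProductManifold.

Program Definition prod_manifold (E F : normedVectType R) (M : manifold E) (N : manifold F) :
    manifold (E * F)%type :=
  @Manifold (E * F)%type (M * N)%type
    [set prod_chart cd.1 cd.2 | cd in @atlas _ M `*` @atlas _ N]
    (fun z => prod_chart (chart_at z.1) (chart_at z.2)) _ _ _ _ _.
Next Obligation.
by move=> E F M N [p q]; exists (chart_at p, chart_at q) => //;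
  split; exact: chart_at_atlas.
Qed.

Next Obligation. by move=> E F M N [p q]; split; exact: chart_at_source. Qed.
Next Obligation.
move=> E F M N _ _ [[c d] [/= Mc Nd] <-] [[c' d'] [/= Mc' Nd'] <-].
rewrite (_ : _ `&` _ = (ctarget c `&` cfrom c @^-1` csource c') `*`
                       (ctarget d `&` cfrom d @^-1` csource d')); last first.
  by apply/seteqP; split=> -[x y] [[/= ? ?] [/= ? ?]].
have := smooth_on_prod (open_transition c c') (open_transition d d')
  (transition_smooth Mc Mc') (transition_smooth Nd Nd').
exact.
Qed.
Next Obligation. by move=> *; apply: hausdorff_prod; exact: manifold_hausdorff. Qed.
Next Obligation.
by move=> *; apply: second_countable_prod; exact: manifold_second_countable.
Qed.

End Manifold.

Section Forms.
Variables (R : realType) (E : normedVectType R) (M : manifold E).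

(* [al p u] and [om p u v] are evaluated on tangent vectors at p. *)
Definition form1 := M -> E -> R.
Definition form2 := M -> E -> E -> R.
Definition form3 := M -> E -> E -> E -> R.

(* The tangent map at x of the inverse of the chart c: it turns a vector in the
   coordinates of c into a vector in the preferred chart at [cfrom c x]. *)
Definition chart_vector (c : chart M E) (x : E) : 'End(E) :=
  linfun ('d (chart_at (cfrom c x) \o cfrom c) x).

Definition local1 (al : form1) (c : chart M E) (x u : E) : R :=
  al (cfrom c x) (chart_vector c x u).

Definition local2 (om : form2) (c : chart M E) (x u v : E) : R :=
  om (cfrom c x) (chart_vector c x u) (chart_vector c x v).

(* Exterior derivatives, computed in the coordinates of the preferred chart at p,
   with the convention d al (X, Y) = X (al Y) - Y (al X) - al [X, Y]. *)
Definition ext_d1 (al : form1) : form2 := fun p u v =>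
  let c := chart_at p in
  'D_u (fun x => local1 al c x v : R^o) (c p)
  - 'D_v (fun x => local1 al c x u : R^o) (c p).

Definition ext_d2 (om : form2) : form3 := fun p u v w =>
  let c := chart_at p in
  'D_u (fun x => local2 om c x v w : R^o) (c p)
  - 'D_v (fun x => local2 om c x u w : R^o) (c p)
  + 'D_w (fun x => local2 om c x u v : R^o) (c p).

Record is_form2 (om : form2) : Prop := IsForm2 {
  form2_linearl : forall p v, linear (fun u => om p u v : R^o);
  form2_linearr : forall p u, linear (fun v => om p u v : R^o);
  form2_alternating : forall p u, om p u u = 0;
  form2_smooth : forall c, atlas c -> forall u v,
    smooth_on (ctarget c) (fun x => local2 om c x u v : R^o) }.

Definition closed2 (om : form2) := forall p u v w, ext_d2 om p u v w = 0.

Record symplectic (om : form2) : Prop := Symplectic {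
  symplectic_form : is_form2 om;
  symplectic_closed : closed2 om;
  symplectic_nondegenerate :
    forall p u, (forall v, om p u v = 0) -> u = 0 }.

End Forms.

Definition pullback2 (R : realType) (E F : normedVectType R) (M : manifold E)
    (N : manifold F) (f : M -> N) (om : form2 N) : form2 M :=
  fun p u v => om (f p) (tmap f p u) (tmap f p v).

Section LieGroup.
Variable R : realType.

Record lie_group (m : nat) := LieGroup {
  lg_manifold :> manifold 'rV[R]_m;
  lg_mul : lg_manifold -> lg_manifold -> lg_manifold;
  lg_one : lg_manifold;
  lg_inv : lg_manifold -> lg_manifold;
  lg_mulA : associative lg_mul;
  lg_mul1 : left_id lg_one lg_mul;
  lg_mulV : left_inverse lg_one lg_inv lg_mul;
  lg_mul_smooth :
    smooth (fun z : prod_manifold lg_manifold lg_manifold => lg_mul z.1 z.2);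
  lg_inv_smooth : smooth lg_inv }.

Definition real_line : manifold R^o := vector_manifold (second_countable_real R).

Variables (m : nat) (G : lie_group m).

(* The exponential map, characterized by the fact that each t |-> exp (tX) is the
   one-parameter subgroup with velocity X at t = 0 (it exists and is unique).
   The Lie algebra g = T_eG has underlying space 'rV_m. *)
Definition is_exponential (expG : 'rV[R]_m -> G) :=
  forall X : 'rV[R]_m,
    let gamma := fun t : real_line => expG ((t : R) *: X) in
    [/\ smooth gamma,
        forall s t : R, gamma (s + t) = lg_mul (gamma s) (gamma t) &
        tmap gamma 0 1 = X].

Definition Ad (g : G) : 'End('rV[R]_m) :=
  tmap (fun h => lg_mul (lg_mul g h) (lg_inv g)) (lg_one G).

(* The dual space g^* is 'cV_m, acting on 'rV_m by matrix multiplication. *)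
Definition pairing (xi : 'cV[R]_m) (X : 'rV[R]_m) : R := (X *m xi) 0 0.

(* The matrix form of the defining identity [pairing_coadjoint] below. *)
Definition coadjoint (g : G) (xi : 'cV[R]_m) : 'cV[R]_m :=
  lin1_mx (Ad (lg_inv g)) *m xi.

Lemma pairing_coadjoint g xi X :
  pairing (coadjoint g xi) X = pairing xi (Ad (lg_inv g) X).
Proof. by rewrite /pairing /coadjoint mulmxA mul_rV_lin1. Qed.

Definition dual_manifold : manifold 'cV[R]_m :=
  vector_manifold (second_countable_mx R m 1).

(* Takes its values in the tangent space at g^-1 g, that is, in g. *)
Definition maurer_cartan (g : G) : 'End('rV[R]_m) :=
  tmap (fun h => lg_mul (lg_inv g) h) g.

(* The 1-form <xi, theta^l> at (g, xi), for theta^l pulled back from G. *)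
Definition tautological : form1 (prod_manifold G dual_manifold) :=
  fun z w => pairing z.2
    (maurer_cartan z.1 (tmap (fst : prod_manifold G dual_manifold -> G) z w)).

Definition omega_can : form2 (prod_manifold G dual_manifold) :=
  fun z u v => - ext_d1 tautological z u v.

Record is_action (E : normedVectType R) (N : manifold E) (a : G -> N -> N) : Prop :=
  IsAction {
    action_smooth : smooth (fun z : prod_manifold G N => a z.1 z.2);
    action_one : forall p, a (lg_one G) p = p;
    action_mul : forall g h p, a (lg_mul g h) p = a g (a h p) }.

(* d/dt a(exp(tX), p) at t = 0. *)
Definition generating (expG : 'rV[R]_m -> G) (E : normedVectType R)
    (N : manifold E) (a : G -> N -> N) (X : 'rV[R]_m) (p : N) : E :=
  tmap (fun t : real_line => a (expG ((t : R) *: X)) p) 0 1.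

Record hamiltonian_action (expG : 'rV[R]_m -> G) (n : nat) (M : manifold 'rV[R]_n)
    (om : form2 M) (a : G -> M -> M) (mu : M -> dual_manifold) : Prop :=
  HamiltonianAction {
    ham_symplectic : symplectic om;
    ham_action : is_action a;
    ham_moment_smooth : smooth mu;
    ham_invariant : forall g p u v, pullback2 (a g) om p u v = om p u v;
    ham_moment : forall X p v,
      pairing (tmap mu p v) X = - om p (generating expG a X p) v;
    ham_equivariant : forall g p, mu (a g p) = coadjoint g (mu p) }.

End LieGroup.

Arguments tautological {R m} G _ _.
Arguments omega_can {R m} G _ _ _.

Section Groupoid.
Variable R : realType.

(* [gmul j k] is meaningful only if the source of j is the target of k. The axioms
   are in [is_lie_groupoid]. *)
Record groupoid_data (EJ EX : normedVectType R) := GroupoidData {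
  arrows : manifold EJ;
  objects : manifold EX;
  src : arrows -> objects;
  tgt : arrows -> objects;
  gunit : objects -> arrows;
  ginv : arrows -> arrows;
  gmul : arrows -> arrows -> arrows }.

Arguments src {EJ EX} _ _.
Arguments tgt {EJ EX} _ _.
Arguments gunit {EJ EX} _ _.
Arguments ginv {EJ EX _} _.
Arguments gmul {EJ EX _} _ _.

(* Since src and tgt are submersions, the set of composable pairs is a fibre
   product in the category of manifolds; hence a map defined on it is smooth iff
   its composites with all smooth maps P -> J x_X J are ([gmul_smooth]). Likewise,
   [sg_multiplicative] below says that m^* Om = pr_1^* Om + pr_2^* Om on the manifold
   of composable pairs, by pulling it back along all smooth maps into it. *)
Record is_lie_groupoid (EJ EX : normedVectType R) (J : groupoid_data EJ EX) : Prop :=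
  IsLieGroupoid {
    src_smooth : smooth (src J);
    tgt_smooth : smooth (tgt J);
    gunit_smooth : smooth (gunit J);
    ginv_smooth : smooth (fun j : arrows J => ginv j);
    src_submersion : forall (j : arrows J) (v : EX), exists u, tmap (src J) j u = v;
    tgt_submersion : forall (j : arrows J) (v : EX), exists u, tmap (tgt J) j u = v;
    gmul_smooth : forall (F : normedVectType R) (P : manifold F) (h k : P -> arrows J),
      smooth h -> smooth k -> (forall z, src J (h z) = tgt J (k z)) ->
      smooth (fun z => gmul (h z) (k z));
    src_gunit : forall x : objects J, src J (gunit J x) = x;
    tgt_gunit : forall x : objects J, tgt J (gunit J x) = x;
    src_gmul : forall j k : arrows J, src J j = tgt J k -> src J (gmul j k) = src J k;
    tgt_gmul : forall j k : arrows J, src J j = tgt J k -> tgt J (gmul j k) = tgt J j;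
    gmulA : forall i j k : arrows J, src J i = tgt J j -> src J j = tgt J k ->
      gmul i (gmul j k) = gmul (gmul i j) k;
    gmul_gunitl : forall j : arrows J, gmul (gunit J (tgt J j)) j = j;
    gmul_gunitr : forall j : arrows J, gmul j (gunit J (src J j)) = j;
    src_ginv : forall j : arrows J, src J (ginv j) = tgt J j;
    tgt_ginv : forall j : arrows J, tgt J (ginv j) = src J j;
    gmul_ginvl : forall j : arrows J, gmul (ginv j) j = gunit J (src J j);
    gmul_ginvr : forall j : arrows J, gmul j (ginv j) = gunit J (tgt J j) }.

Record is_lie_groupoid_morphism (EJ EX EK EN : normedVectType R)
    (J : groupoid_data EJ EX) (K : groupoid_data EK EN)
    (Phi : arrows J -> arrows K) (Phi0 : objects J -> objects K) : Prop :=
  IsLieGroupoidMorphism {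
    morphism_smooth : smooth Phi;
    morphism_smooth0 : smooth Phi0;
    morphism_src : forall j, src K (Phi j) = Phi0 (src J j);
    morphism_tgt : forall j, tgt K (Phi j) = Phi0 (tgt J j);
    morphism_gunit : forall x, Phi (gunit J x) = gunit K (Phi0 x);
    morphism_gmul : forall i j, src J i = tgt J j ->
      Phi (gmul i j) = gmul (Phi i) (Phi j) }.

Record symplectic_groupoid (EK EN : normedVectType R) (K : groupoid_data EK EN)
    (Om : form2 (arrows K)) : Prop := SymplecticGroupoid {
  sg_lie_groupoid : is_lie_groupoid K;
  sg_symplectic : symplectic Om;
  sg_multiplicative :
    forall (F : normedVectType R) (P : manifold F) (h k : P -> arrows K),
      smooth h -> smooth k -> (forall z, src K (h z) = tgt K (k z)) ->
      forall z u v, pullback2 (fun z => gmul (h z) (k z)) Om z u v =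
        pullback2 h Om z u v + pullback2 k Om z u v }.

Definition groupoid_delta (EJ EX : normedVectType R) (J : groupoid_data EJ EX)
    (eta : form2 (objects J)) : form2 (arrows J) :=
  fun j u v => pullback2 (src J) eta j u v - pullback2 (tgt J) eta j u v.

Definition action_groupoid (m : nat) (G : lie_group R m) (E : normedVectType R)
    (N : manifold E) (a : G -> N -> N) : groupoid_data ('rV[R]_m * E)%type E :=
  @GroupoidData ('rV[R]_m * E)%type E (prod_manifold G N) N
    (fun z => z.2) (fun z => a z.1 z.2) (fun p => (lg_one G, p))
    (fun z => (lg_inv z.1, a z.1 z.2)) (fun z w => (lg_mul z.1 w.1, w.2)).

Definition cotangent_groupoid (m : nat) (G : lie_group R m) :=
  action_groupoid (N := dual_manifold R m) (@coadjoint R m G).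

End Groupoid.

Arguments src {R EJ EX} _ _.
Arguments tgt {R EJ EX} _ _.
Arguments gunit {R EJ EX} _ _.
Arguments ginv {R EJ EX _} _.
Arguments gmul {R EJ EX _} _ _.

Section Complexes.
Variable R : realType.

(* Three-term sequences in degrees -1, 0, 1. *)
Record complex3 := Complex3 {
  deg_m1 : lmodType R; deg_0 : lmodType R; deg_1 : lmodType R;
  diff_m1 : deg_m1 -> deg_0;
  diff_0 : deg_0 -> deg_1 }.

Definition is_complex (C : complex3) :=
  [/\ linear (@diff_m1 C), linear (@diff_0 C) &
      forall x, diff_0 (@diff_m1 C x) = 0].

Record map3 (C D : complex3) := Map3 {
  map_m1 : deg_m1 C -> deg_m1 D;
  map_0 : deg_0 C -> deg_0 D;
  map_1 : deg_1 C -> deg_1 D }.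

Definition is_cochain_map (C D : complex3) (f : map3 C D) :=
  [/\ linear (map_m1 f), linear (map_0 f), linear (map_1 f),
      forall x, map_0 f (diff_m1 x) = diff_m1 (map_m1 f x) &
      forall x, map_1 f (diff_0 x) = diff_0 (map_0 f x)].

(* Bijectivity (injectivity and surjectivity) of the map Z / B -> Z' / B' induced
   by f, when f maps Z to Z' and B to B'. *)
Definition quotient_bijective (V W : lmodType R) (Z B : set V) (Z' B' : set W)
    (f : V -> W) :=
  (forall z, Z z -> B' (f z) -> B z) /\
  (forall w, Z' w -> exists2 z, Z z & B' (w - f z)).

Definition quasi_isomorphism (C D : complex3) (f : map3 C D) :=
  [/\ is_complex C, is_complex D, is_cochain_map f &
  [/\ quotient_bijective [set x | @diff_m1 C x = 0] [set 0]
        [set y | @diff_m1 D y = 0] [set 0] (map_m1 f),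
      quotient_bijective [set x | @diff_0 C x = 0] (range (@diff_m1 C))
        [set y | @diff_0 D y = 0] (range (@diff_m1 D)) (map_0 f) &
      quotient_bijective setT (range (@diff_0 C))
        setT (range (@diff_0 D)) (map_1 f)]].

End Complexes.

Section ShiftedLagrangian.
Variable R : realType.

(* The fibre at x of A_J = ker Ts restricted to the units. *)
Definition lie_algebroid (EJ EX : normedVectType R) (J : groupoid_data EJ EX)
    (x : objects J) : {vspace EJ} := lker (tmap (src J) (gunit J x)).

Arguments lie_algebroid {EJ EX} J x.

(* The differential -Tt : A_J -> TX of the tangent complex. *)
Definition algebroid_d (EJ EX : normedVectType R) (J : groupoid_data EJ EX)
    (x : objects J) (a : subvs_of (lie_algebroid J x)) : EX :=
  - tmap (tgt J) (gunit J x) (vsval a).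

Variables (EJ EX EK EN : normedVectType R).
Variables (J : groupoid_data EJ EX) (K : groupoid_data EK EN).
Variables (Phi : arrows J -> arrows K) (Phi0 : objects J -> objects K).

(* [vsproj] only puts T Phi a, which lies in A_K when Phi is a groupoid morphism,
   into the type of elements of A_K. *)
Definition normal_complex (x : objects J) : complex3 R :=
  @Complex3 R (subvs_of (lie_algebroid J x))
    (EX * subvs_of (lie_algebroid K (Phi0 x)))%type EN
    (fun a => (algebroid_d a,
               vsproj (lie_algebroid K (Phi0 x)) (tmap Phi (gunit J x) (vsval a))))
    (fun vw => tmap Phi0 x vw.1 - algebroid_d vw.2).

(* 0 -> T_x^*X -> A_J^*, with second map minus the transpose of the differential
   of A_J -> TX. *)
Definition cotangent_complex (x : objects J) : complex3 R :=
  @Complex3 R 'rV[R]_0 'Hom(EX, R^o) 'Hom(subvs_of (lie_algebroid J x), R^o)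
    (fun=> 0)
    (fun al => linfun (fun a : subvs_of (lie_algebroid J x) => - al (algebroid_d a))).

Definition lagrangian_map (Om : form2 (arrows K)) (eta : form2 (objects J))
    (x : objects J) : map3 (normal_complex x) (cotangent_complex x) :=
  let T1 := tmap (gunit K) (Phi0 x) in
  @Map3 R (normal_complex x) (cotangent_complex x)
    (fun=> 0)
    (fun vw => linfun (fun u : EX =>
       - eta x vw.1 u + Om (gunit K (Phi0 x)) (vsval vw.2) (T1 (tmap Phi0 x u)) : R^o))
    (fun w => linfun (fun a : subvs_of (lie_algebroid J x) =>
       Om (gunit K (Phi0 x)) (T1 w) (tmap Phi (gunit J x) (vsval a)) : R^o)).

Record isotropic_structure (Om : form2 (arrows K)) (eta : form2 (objects J)) : Prop :=
  IsotropicStructure {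
    iso_form : is_form2 eta;
    iso_delta : forall j u v, pullback2 Phi Om j u v = groupoid_delta eta j u v;
    iso_closed : closed2 eta }.

Record shifted_lagrangian (Om : form2 (arrows K)) (eta : form2 (objects J)) : Prop :=
  ShiftedLagrangian {
    sl_source : is_lie_groupoid J;
    sl_target : symplectic_groupoid Om;
    sl_morphism : is_lie_groupoid_morphism Phi Phi0;
    sl_isotropic : isotropic_structure Om eta;
    sl_nondegenerate : forall x, quasi_isomorphism (lagrangian_map Om eta x) }.

End ShiftedLagrangian.

Arguments lie_algebroid {R EJ EX} J x.

(* Main.v *)
Require Import Defs.
Set Warnings "-notation-overridden,-ambiguous-paths,-notation-incompatible-prefix,-redundant-canonical-projection".
From HB Require Import structures.
From mathcomp Require Import all_boot all_order all_algebra.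
From mathcomp Require Import all_classical all_reals all_analysis.
From mathcomp Require Import ring.
Import Order.TTheory GRing.Theory Num.Theory.
Import numFieldNormedType.Exports.

(** Write rho(X) for the infinitesimal action of X on M, rho* for the
    infinitesimal coadjoint action on the dual g^* of the Lie algebra, and mc for
    the left Maurer-Cartan form of G.  Everything rests on one formula for the
    canonical form ([omega_canE]): at (g, xi), with X = mc u and Y = mc u',
      omega_can ((u, eta), (u', eta')) = <eta', X> - <eta, Y> + <rho*(Y)_xi, X>.
    It is obtained without computing the exterior derivative of mc.  The
    tautological form is pulled back along
      (s, t, xi) |-> (g exp(sX) exp(tY), xi),
    where the product rule [maurer_cartan_mul] turns it into
      <Ad^*_(exp tY) xi, X> ds + <xi, Y> dt,
    whose exterior derivative is elementary; naturality of d
    ([ext_d1_pullback]) carries the result back to G x g^*.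

    The cotangent groupoid is symplectic ([cotangent_symplectic_groupoid]):
    omega_can is exact, hence closed; the formula gives its nondegeneracy; and
    the tautological form is itself multiplicative, again by the product rule, so
    its differential is multiplicative by naturality.

    The form omega is an isotropic structure ([pullback_omega_can]): the target
    map of the action groupoid has differential a_g (rho(mc u) + v) at (g, p), so
    invariance of omega makes s^* omega - t^* omega an expression in omega_p, X, Y,
    v and v'.  Equivariance of mu says rho*(Y) = dmu (rho(Y)), and the moment
    condition <dmu v, X> = - omega (rho(X), v) turns the formula for omega_can into
    the same expression.

    For nondegeneracy ([moment_lagrangian]), both algebroids have fibre g at each
    point, and the comparison map becomes
      (v, W) |-> - omega (v + rho(W), _)   and   eta |-> - <eta, _>
    in degrees 0 and 1, from the complex X |-> (- rho(X), X),
    (v, W) |-> dmu (v + rho(W)).  Since omega induces an isomorphism of the tangent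
    and cotangent spaces and g^* is the dual of g, this is a quasi-isomorphism.

    Two pieces of calculus support this: the closure of C^k maps under
    composition ([Ck_on_comp]), which makes smoothness of maps between manifolds a
    local matter, and the symmetry of second derivatives ([derive_sym]), which
    gives dd = 0 as well as the naturality of d. *)

Set Implicit Arguments. Unset Strict Implicit. Unset Printing Implicit Defensive.
Local Open Scope classical_set_scope.
Local Open Scope ring_scope.

(** * Coordinates on finite-dimensional normed spaces *)

Section FiniteDimension.
Variable R : realType.
Implicit Types E F : normedVectType R.

Lemma cvg_sumr (V : normedModType R) (T I : Type) (F : set_system T)
    {FF : Filter F} (r : seq I) (f : I -> T -> V) (l : I -> V) :
  (forall i, f i @ F --> l i) ->
  (fun x => \sum_(i <- r) f i x) @ F --> \sum_(i <- r) l i.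
Proof.
move=> fl; elim: r => [|i r IH].
  by rewrite big_nil; under eq_fun do rewrite big_nil; exact: cvg_cst.
by rewrite big_cons; under eq_fun do rewrite big_cons; exact: cvgD.
Qed.

Definition bvect E (i : 'I_(\dim {:E})) : E := (vbasis {:E})`_i.

(** Valued in [R^o], so that coordinates can be differentiated. *)
Definition bcoord E (i : 'I_(\dim {:E})) : E -> R^o := coord (vbasis {:E}) i.

HB.instance Definition _ E i := GRing.Linear.on (@bcoord E i).

Lemma bcoordE E (x : E) : x = \sum_i bcoord i x *: bvect i.
Proof. exact: coord_vbasis (memvf x). Qed.

(** Equivalence of norms: the image of the compact unit sphere of the coordinate
    space does not contain 0, so its norm has a positive minimum there. *)
Lemma bcoord_continuous E (i : 'I_(\dim {:E})) : continuous (@bcoord E i).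
Proof.
pose phi (x : 'rV[R]_(\dim {:E})) : E := \sum_i x ord0 i *: bvect i.
have cphi : continuous phi.
  move=> x; rewrite /phi; apply: (@cvg_sumr _ _ _ (nbhs x)) => j.
  by apply: (@cvgZr_tmp _ _ _ (nbhs x)); exact: coord_continuous.
have phiK x : phi x = 0 -> x = 0.
  move=> /= x0; apply/rowP => j; rewrite mxE.
  have /freeP := basis_free (vbasisP {:E}); exact.
have phiZ k x : phi (k *: x) = k *: phi x.
  by rewrite /phi scaler_sumr; apply: eq_bigr => j _; rewrite mxE scalerA.
pose S := [set x : 'rV[R]_(\dim {:E}) | `|x| = 1].
have [c c0 cP] : exists2 c : R, 0 < c & forall x, S x -> c <= `|phi x|.
  have [S0|/set0P S0] := eqVneq S set0; first by exists 1 => // x; rewrite S0.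
  have [||x xS xP] := @EVT_min_rV R _ (fun x => `|phi x|) S S0.
  - apply: bounded_closed_compact.
      by exists 1; split=> // M M1 x /= ->; exact: ltW.
    rewrite (_ : S = (fun x => `|x|) @^-1` [set 1])//.
    apply: preimage_closed; last exact: closed_eq.
    by move=> x _; exact: norm_continuous.
  - apply: continuous_subspaceT => x.
    by apply: continuous_comp; [exact: cphi|exact: norm_continuous].
  exists `|phi x|; last by move=> y Sy; apply: xP; rewrite inE.
  rewrite normr_gt0; apply: contraPneq xS => /phiK ->.
  by rewrite inE /S /= normr0 => /esym/eqP; rewrite oner_eq0.
have le_phi x : c * `|x| <= `|phi x|.
  have [->|x0] := eqVneq x 0; first by rewrite normr0 mulr0.
  have x0' : 0 < `|x| by rewrite normr_gt0.
  have : c <= `|phi (`|x|^-1 *: x)|.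
    by apply: cP; rewrite /S /= normrZ normfV normr_id mulVf ?gt_eqF.
  by rewrite phiZ normrZ normfV normr_id ler_pdivlMl// mulrC.
apply: bounded_linear_continuous; apply/linear_boundedP.
near=> r => x.
pose X := \row_j bcoord j x.
have xE : x = phi X by rewrite /phi [LHS]bcoordE; apply: eq_bigr => j _; rewrite mxE.
have : `|X ord0 i| <= `|X|.
  by rewrite {2}/Num.norm /= mx_normrE; apply/bigmax_geP; right => /=; exists (ord0, i).
rewrite [X ord0 i]mxE => /le_trans; apply.
rewrite -(ler_pM2l c0); apply: (le_trans (le_phi X)).
rewrite -xE mulrA ler_peMl// mulrC -ler_pdivrMr//.
Unshelve. all: by end_near. Qed.

Lemma findim_linear_continuous E (F : normedModType R) (f : {linear E -> F}) :
  continuous f.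
Proof.
have fE : (f : E -> F) = (fun y => \sum_i bcoord i y *: f (bvect i)).
  apply/funext => y; rewrite {1}[y]bcoordE linear_sum.
  by apply: eq_bigr => i _; rewrite linearZ.
move=> x; rewrite fE; apply: (@cvg_sumr F _ _ (nbhs x)) => i.
exact: cvgZr_tmp (@bcoord_continuous _ i x).
Qed.

Lemma findim_is_diff E (F : normedModType R) (f : {linear E -> F}) x :
  is_diff x f f.
Proof.
apply: DiffDef; last by rewrite diff_lin//; exact: findim_linear_continuous.
by apply: linear_differentiable; exact: findim_linear_continuous.
Qed.

End FiniteDimension.

(** * Calculus of C^k maps *)

Section CkCalculus.
Variable R : realType.
Implicit Types E F H : normedVectType R.

Lemma near_open (T : topologicalType) (U : set T) x :
  open U -> U x -> \forall y \near x, U y.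
Proof. by move=> oU Ux; apply: open_nbhs_nbhs. Qed.

Lemma near_all (T : topologicalType) (x : T) (P : T -> Prop) :
  (forall y, P y) -> \forall y \near x, P y.
Proof. by move=> allP; apply: filterE. Qed.

Lemma Ck_on_sub E F k (U V : set E) (f : E -> F) :
  U `<=` V -> Ck_on k V f -> Ck_on k U f.
Proof.
move=> UV; elim: k f => [|k IH] f /=; first by move=> cf x /UV; exact: cf.
by move=> [df Df]; split=> [x /UV|v]; [exact: df|exact: IH].
Qed.

Lemma Ck_on_local E F k (U : set E) (f : E -> F) :
  (forall x, U x -> exists2 V, V x & Ck_on k V f) -> Ck_on k U f.
Proof.
elim: k f => [|k IH] f Uf /=.
  by move=> x /Uf[V Vx]; exact.
split=> [x /Uf[V Vx [+ _]]|v]; first exact.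
apply: IH => x /Uf[V Vx [_ Df]]; exists V => //; exact: Df.
Qed.

Lemma Ck_onS E F k (U : set E) (f : E -> F) : Ck_on k.+1 U f -> Ck_on k U f.
Proof.
elim: k f => [|k IH] f [df Df].
  by move=> x Ux; exact: differentiable_continuous (df _ Ux).
by split=> // v; exact: IH (Df v).
Qed.

Lemma Ck_on_linear E F H k (U : set E) (L : {linear F -> H}) (f : E -> F) :
  open U -> Ck_on k U f -> Ck_on k U (L \o f).
Proof.
move=> oU; elim: k f => [|k IH] f /=.
  move=> cf x Ux; apply: continuous_comp; first exact: cf.
  exact: findim_linear_continuous.
move=> [df Df]; have dL y := @findim_is_diff _ _ _ L y.
have dLf x : U x -> is_diff x (L \o f) (L \o 'd f x).
  by move=> /df/differentiableP dfx; exact: is_diff_comp.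
split=> [x /dLf[]//|v]; apply: Ck_on_eq (IH _ (Df v)) => // x; rewrite inE => Ux.
by have [dx ex] := dLf x Ux; rewrite [RHS]deriveE// ex /= deriveE//; exact: df.
Qed.

Lemma Ck_onD E F k (U : set E) (f g : E -> F) : open U ->
  Ck_on k U f -> Ck_on k U g -> Ck_on k U (fun x => f x + g x).
Proof.
move=> oU; elim: k f g => [|k IH] f g /=.
  by move=> cf cg x Ux; apply: continuousD; [exact: cf|exact: cg].
move=> [df Df] [dg Dg]; split=> [x Ux|v].
  by apply: (@differentiableD _ _ _ f g); [exact: df|exact: dg].
apply: Ck_on_eq (IH _ _ (Df v) (Dg v)) => // x; rewrite inE => Ux.
by rewrite -deriveD//; apply: diff_derivable; [exact: df|exact: dg].
Qed.

Lemma Ck_on_sum E F k (U : set E) n (f : 'I_n -> E -> F) : open U ->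
  (forall i, Ck_on k U (f i)) -> Ck_on k U (fun x => \sum_i f i x).
Proof.
move=> oU; elim: n f => [|n IH] f kf.
  rewrite (_ : (fun _ => _) = cst 0); first exact: Ck_on_cst.
  by apply/funext => x; rewrite big_ord0.
rewrite (_ : (fun _ => _) = fun x => f ord0 x + \sum_i f (lift ord0 i) x).
  by apply: Ck_onD => //; exact: IH.
by apply/funext => x; rewrite big_ord_recl.
Qed.

Lemma is_diff_scale E F (s ds : E -> R^o) (g dg : E -> F) x :
  is_diff x s ds -> is_diff x g dg ->
  is_diff x (fun y => s y *: g y) (fun v => s x *: dg v + ds v *: g x).
Proof.
move=> s_ g_.
have bil : bilinear_for (GRing.Scale.Law.clone _ _ *:%R _)
    (GRing.Scale.Law.clone _ _ *:%R _) (fun (a : R^o) (w : F) => a *: w).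
  split=> [u'|u] a y z /=; first by rewrite scalerDl scalerA.
  by rewrite scalerDr !scalerA mulrC.
pose BM := bilinear_isBilinear.Build R R^o F F _ _ _ bil.
pose B : {bilinear R^o -> F -> F} := HB.pack (fun (a : R^o) (w : F) => a *: w) BM.
have cB : continuous (fun p : R^o * F => B p.1 p.2).
  by move=> p; exact: scale_continuous.
have dB : is_diff (s x, g x) (fun p : R^o * F => B p.1 p.2)
    (fun q => s x *: q.2 + q.1 *: g x).
  by apply: DiffDef; [exact: differentiable_bilin|rewrite diff_bilin].
have dsg : is_diff x (fun y => (s y, g y)) (fun v => (ds v, dg v)).
  exact: is_diff_pair.
exact: (@is_diff_comp _ _ _ _ (fun y => (s y, g y)) _
  (fun p : R^o * F => B p.1 p.2)).
Qed.

Lemma Ck_onZ E F k (U : set E) (s : E -> R^o) (g : E -> F) : open U ->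
  Ck_on k U s -> Ck_on k U g -> Ck_on k U (fun x => s x *: g x).
Proof.
move=> oU; elim: k s g => [|k IH] s g.
  by move=> /= cs cg x Ux; exact: continuousZ (cs x Ux) (cg x Ux).
move=> ks kg; have [ds Ds] := ks; have [dg Dg] := kg.
have dsg x : U x -> is_diff x (fun y => s y *: g y)
    (fun v => s x *: 'd g x v + ('d s x v : R^o) *: g x).
  move=> Ux; have /differentiableP dsx := ds x Ux.
  by have /differentiableP dgx := dg x Ux; exact: is_diff_scale.
split=> [x /dsg[]//|v].
apply: (@Ck_on_eq _ _ _ _ _ (fun x => s x *: 'D_v g x + 'D_v s x *: g x)) => //.
  move=> x; rewrite inE => Ux; have [dx ex] := dsg x Ux.
  by rewrite [RHS]deriveE// ex !deriveE//; [exact: ds|exact: dg].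
by apply: Ck_onD => //; [exact: IH (Ck_onS ks) (Dg v)|exact: IH (Ds v) (Ck_onS kg)].
Qed.

Lemma derive_bcoord E F (f : E -> F) x v : differentiable f x ->
  'D_v f x = \sum_i bcoord i v *: 'D_(bvect i) f x.
Proof.
move=> df; rewrite deriveE// [v in LHS]bcoordE linear_sum.
by apply: eq_bigr => i _; rewrite linearZ deriveE.
Qed.

Lemma derive_comp E F H (f : E -> F) (g : F -> H) x v :
  differentiable f x -> differentiable g (f x) ->
  'D_v (g \o f) x = 'D_('D_v f x) g (f x).
Proof.
move=> df dg; rewrite deriveE; last exact: differentiable_comp.
by rewrite diff_comp// /= deriveE// deriveE.
Qed.

(** Expanding the direction D_v f in coordinates writes D_v (g o f) as
    sum_i (D_v f)_i * (D_i g o f), a combination of C^k maps to which the induction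
    hypothesis applies. *)
Lemma Ck_on_comp E F H k (U : set E) (V : set F) (f : E -> F) (g : F -> H) :
  open U -> (forall x, U x -> V (f x)) ->
  Ck_on k U f -> Ck_on k V g -> Ck_on k U (g \o f).
Proof.
move=> oU UV; elim: k g => [|k IH] g.
  by move=> cf cg x Ux; apply: continuous_comp; [exact: cf|exact/cg/UV].
move=> kf [dg Dg]; have [df Df] := kf.
split=> [x Ux|v].
  by apply: differentiable_comp; [exact: df|exact/dg/UV].
apply: (@Ck_on_eq _ _ _ _ _
    (fun x => \sum_i bcoord i ('D_v f x) *: ('D_(bvect i) g \o f) x)) => //.
  move=> x; rewrite inE => Ux; rewrite derive_comp//; [|exact: df|exact/dg/UV].
  by rewrite [RHS]derive_bcoord//; exact/dg/UV.
apply: Ck_on_sum => // i; apply: Ck_onZ => //.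
  exact: (Ck_on_linear (@bcoord R F i) oU (Df v)).
exact: IH (Ck_onS kf) (Dg _).
Qed.

Lemma Ck_on_pair E F H k (U : set E) (f : E -> F) (g : E -> H) : open U ->
  Ck_on k U f -> Ck_on k U g -> Ck_on k U (fun x => (f x, g x) : (F * H)%type).
Proof.
move=> oU; elim: k f g => [|k IH] f g /=.
  by move=> cf cg x Ux; apply: cvg_pair; [exact: cf|exact: cg].
move=> [df Df] [dg Dg]; split=> [x Ux|v].
  by apply: differentiable_pair; [exact: df|exact: dg].
apply: Ck_on_eq (IH _ _ (Df v) (Dg v)) => // x; rewrite inE => Ux.
have dfx := df x Ux; have dgx := dg x Ux.
rewrite [RHS]deriveE; last exact: differentiable_pair.
by rewrite diff_pair// !deriveE.
Qed.

End CkCalculus.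

(** * Symmetry of second derivatives *)

Section Schwarz.
Variable R : realType.
Variable E : normedVectType R.

Lemma is_diff_line (u c : E) (s : R^o) :
  is_diff s (fun s : R^o => (s : R) *: u + c) (fun h : R^o => (h : R) *: u).
Proof.
have d1 : is_diff s (fun s : R^o => (s : R) *: u) (fun h : R^o => (h : R) *: u).
  exact: is_diff_scalel.
have := is_diffD d1 (is_diff_cst c s); rewrite addr0; exact.
Qed.

Lemma derive_along_line (f : E -> R^o) (u c : E) (s : R) :
  differentiable f (s *: u + c) ->
  is_derive (s : R^o) (1 : R^o) (fun s : R^o => f ((s : R) *: u + c))
    ('D_u f (s *: u + c)).
Proof.
move=> df; have dl := is_diff_line u c s.
have /differentiableP df' := df.
have [dg eg] : is_diff (s : R^o) (f \o (fun s : R^o => (s : R) *: u + c))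
    ('d f (s *: u + c) \o (fun h : R^o => (h : R) *: u)).
  exact: is_diff_comp.
apply: DeriveDef; first exact: diff_derivable.
by rewrite deriveE// eg /= scale1r deriveE.
Qed.

(** The mean value theorem in direction u, then in direction v.  The second
    difference on the left is symmetric in u and v, the right-hand side is not:
    hence the symmetry of second derivatives. *)
Lemma increment_mvt (f : E -> R^o) (U : set E) (x u v : E) (t : R) :
  open U -> Ck_on 2 U f -> 0 < t ->
  (forall a b, 0 <= a <= t -> 0 <= b <= t -> U (x + a *: u + b *: v)) ->
  exists a b, [/\ 0 <= a <= t, 0 <= b <= t &
    (f (x + t *: u + t *: v) : R) - ((f (x + t *: u) : R) + f (x + t *: v)) + f x =
    'D_v (fun y => 'D_u f y) (x + a *: u + b *: v) * t * t].
Proof.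
move=> oU [df Df] t0 Ut.
have tt : 0 <= t <= t by rewrite ltW//=.
have t00 : 0 <= (0 : R) <= t by rewrite lexx ltW.
have Ut0 a : 0 <= a <= t -> U (a *: u + x).
  by move=> at0; have := Ut a 0 at0 t00; rewrite scale0r addr0 addrC.
have Utt a : 0 <= a <= t -> U (a *: u + (x + t *: v)).
  by move=> at0; have := Ut a t at0 tt; rewrite addrA [a *: u + x]addrC.
pose phi (s : R^o) : R^o := f ((s : R) *: u + (x + t *: v)) - f ((s : R) *: u + x).
pose dphi (s : R) : R := 'D_u f (s *: u + (x + t *: v)) - 'D_u f (s *: u + x).
have phi_derive s : 0 <= s <= t -> is_derive (s : R^o) (1 : R^o) phi (dphi s).
  move=> st; have d1 := derive_along_line (df _ (Utt s st)).
  by have d2 := derive_along_line (df _ (Ut0 s st)); exact: is_deriveB.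
have sub s : s \in `]0, t[%R -> 0 <= s <= t.
  by rewrite in_itv /= => /andP[? ?]; rewrite !ltW.
have [||a /sub ha phia] := @MVT R phi dphi 0 t t0.
- by move=> s /sub; exact: phi_derive.
- apply: derivable_within_continuous => s; rewrite in_itv /= => st.
  by have [] := phi_derive s st.
pose psi (s : R^o) : R^o := 'D_u f ((s : R) *: v + (x + a *: u)).
pose dpsi (s : R) : R := 'D_v (fun y => 'D_u f y) (s *: v + (x + a *: u)).
have psi_derive s : 0 <= s <= t -> is_derive (s : R^o) (1 : R^o) psi (dpsi s).
  move=> st; apply: derive_along_line; apply: (Df u).1.
  by rewrite addrC; exact: Ut.
have [||b /sub hb psib] := @MVT R psi dpsi 0 t t0.
- by move=> s /sub; exact: psi_derive.
- apply: derivable_within_continuous => s; rewrite in_itv /= => st.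
  by have [] := psi_derive s st.
exists a, b; split=> //.
have -> : (f (x + t *: u + t *: v) : R) - ((f (x + t *: u) : R) + f (x + t *: v)) + f x =
    phi t - phi 0.
  rewrite /phi !scale0r !add0r [t *: u + x]addrC [t *: u + (x + _)]addrCA addrA.
  by rewrite opprD opprB !addrA [_ + f x]addrAC.
have dphiE : dphi a = psi t - psi 0.
  by rewrite /psi /dphi scale0r add0r [a *: u + x]addrC addrCA [t *: v + _]addrCA
    [a *: u + t *: v]addrC.
by rewrite phia dphiE psib !subr0 /dpsi [b *: v + _]addrC.
Qed.

(** Both second derivatives at x are limits of the same second difference,
    by continuity at the intermediate points of [increment_mvt]. *)
Lemma derive_sym (f : E -> R^o) (U : set E) (x u v : E) :
  open U -> Ck_on 2 U f -> U x ->
  'D_u (fun y => 'D_v f y) x = 'D_v (fun y => 'D_u f y) x.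
Proof.
move=> oU f2 Ux; have [df Df] := f2.
have cont w z : {for x, continuous (fun y => 'D_w (fun y => 'D_z f y) y)}.
  exact: (Df z).2 w x Ux.
apply/eqP; rewrite -subr_eq0 -normr_le0; apply/ler_addgt0Pl => e e0.
have e20 : 0 < e / 2 by rewrite divr_gt0.
have h1 := (cvgrPdist_lt _ _ (FF := nbhs_filter x)).1 (cont u v) _ e20.
have h2 := (cvgrPdist_lt _ _ (FF := nbhs_filter x)).1 (cont v u) _ e20.
have h3 := near_open oU Ux.
have [d /= d0 xd] := (nbhs_ballP _ _).1 (filterI h3 (filterI h1 h2)).
(* The parallelogram of side t spanned by u and v stays in the ball of radius d. *)
pose t := d / (`|u| + `|v| + 1).
have halves (A B C : R) : `|A - C| < e / 2 -> `|B - C| < e / 2 -> `|A - B| <= e + 0.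
  move=> AC BC; rewrite addr0 [e]splitr -[A](subrK C) -addrA.
  by rewrite (le_trans (ler_normD _ _))// lerD// ltW// distrC.
have uv0 : 0 < `|u| + `|v| + 1 by rewrite ltr_wpDl// addr_ge0.
have t0 : 0 < t by rewrite divr_gt0.
have near_x a b : 0 <= a <= t -> 0 <= b <= t -> ball x d (x + a *: u + b *: v).
  move=> /andP[a0 at_] /andP[b0 bt]; rewrite -ball_normE /= -addrA opprD addNKr.
  rewrite normrN (le_lt_trans (ler_normD _ _))// !normrZ !ger0_norm//.
  rewrite (@le_lt_trans _ _ (t * (`|u| + `|v|)))//.
    by rewrite mulrDr lerD// ler_wpM2r.
  by rewrite /t mulrAC ltr_pdivrMr// ltr_pM2l// ltrDl.
have [a [b [ha hb e1]]] : exists a b, [/\ 0 <= a <= t, 0 <= b <= t &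
    (f (x + t *: u + t *: v) : R) - ((f (x + t *: u) : R) + f (x + t *: v)) + f x =
    'D_v (fun y => 'D_u f y) (x + a *: u + b *: v) * t * t].
  by apply: increment_mvt oU f2 t0 _ => a b ha hb; have [] := xd _ (near_x _ _ ha hb).
have near_x' a' b' : 0 <= a' <= t -> 0 <= b' <= t ->
    ball x d (x + a' *: v + b' *: u).
  by move=> ha' hb'; rewrite addrAC; exact: near_x.
have [a' [b' [ha' hb' e2]]] : exists a b, [/\ 0 <= a <= t, 0 <= b <= t &
    (f (x + t *: v + t *: u) : R) - ((f (x + t *: v) : R) + f (x + t *: u)) + f x =
    'D_u (fun y => 'D_v f y) (x + a *: v + b *: u) * t * t].
  by apply: increment_mvt oU f2 t0 _ => c c' hc hc'; have [] := xd _ (near_x' _ _ hc hc').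
have {e1 e2} e12 : 'D_v (fun y => 'D_u f y) (x + a *: u + b *: v) =
    'D_u (fun y => 'D_v f y) (x + a' *: v + b' *: u).
  move: e1; rewrite [x + t *: u + _]addrAC [X in _ - X + _]addrC e2.
  by move=> /(mulIf (lt0r_neq0 t0))/(mulIf (lt0r_neq0 t0))/esym.
have [_ [_ {}h1]] := xd _ (near_x _ _ ha hb).
have [_ [{}h2 _]] := xd _ (near_x' _ _ ha' hb').
rewrite e12 in h1; exact: halves h2 h1.
Qed.

End Schwarz.

(** * Local smoothness *)

Section LocalSmooth.
Variable R : realType.
Implicit Types E F H : normedVectType R.

Lemma near_openP E (P : set E) x :
  nbhs x P -> exists2 V, open_nbhs x V & forall y, V y -> P y.
Proof. by rewrite nbhsE. Qed.

(** One neighbourhood has to serve for all orders of differentiation. *)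
Definition smooth_near E F (f : E -> F) (x : E) :=
  exists2 U, open_nbhs x U & smooth_on U f.

Lemma smooth_on_near E F (U : set E) (f : E -> F) x :
  open U -> U x -> smooth_on U f -> smooth_near f x.
Proof. by move=> oU Ux sf; exists U. Qed.

Lemma smooth_on_of_near E F (U : set E) (f : E -> F) :
  (forall x, U x -> smooth_near f x) -> smooth_on U f.
Proof.
by move=> Uf k; apply: Ck_on_local => x /Uf[V [oV Vx] sf]; exists V.
Qed.

Lemma near_smooth_near E F (f : E -> F) x : smooth_near f x -> \near x, smooth_near f x.
Proof.
move=> [U [oU Ux] sf]; apply: filterS (near_open oU Ux) => y Uy.
exact: smooth_on_near sf.
Qed.

Lemma smooth_near_eq E F (f g : E -> F) x :
  (\near x, f x = g x) -> smooth_near f x -> smooth_near g x.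
Proof.
move=> fg [U [oU Ux] sf].
have [V [oV Vx] VP] := near_openP fg.
exists (U `&` V); first by split; [exact: openI|].
move=> k; apply: (@Ck_on_eq _ _ _ _ _ f); first exact: openI.
  by move=> y; rewrite inE => -[_ /VP].
by apply: Ck_on_sub (sf k) => y [].
Qed.

Lemma smooth_near_continuous E F (f : E -> F) x : smooth_near f x -> {for x, continuous f}.
Proof. by move=> [U [oU Ux] /(_ 0%N)]; exact. Qed.

Lemma smooth_near_differentiable E F (f : E -> F) x : smooth_near f x -> differentiable f x.
Proof. by move=> [U [oU Ux] /(_ 1%N)[+ _]]; exact. Qed.

Lemma smooth_near_derive E F (f : E -> F) v x :
  smooth_near f x -> smooth_near (fun y => 'D_v f y) x.
Proof. by move=> [U Ux sf]; exists U => // k; exact: (sf k.+1).2. Qed.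

Lemma smooth_near_comp E F H (f : E -> F) (g : F -> H) x :
  smooth_near f x -> smooth_near g (f x) -> smooth_near (g \o f) x.
Proof.
move=> sf [V [oV Vfx] sg].
have fV : \forall y \near x, V (f y).
  by have := smooth_near_continuous sf; apply; exact: near_open.
have [U [oU Ux] UP] := near_openP (filterI (near_smooth_near sf) fV).
exists U => // k; apply: (@Ck_on_comp _ _ _ _ _ _ V) => //.
- by move=> y /UP[].
- by apply: smooth_on_of_near => y /UP[].
Qed.

Lemma smooth_near_pair E F H (f : E -> F) (g : E -> H) x :
  smooth_near f x -> smooth_near g x -> smooth_near (fun x => (f x, g x) : (F * H)%type) x.
Proof.
move=> [U [oU Ux] sf] [V [oV Vx] sg]; exists (U `&` V); first by split; [exact: openI|].
move=> k; apply: Ck_on_pair; first exact: openI.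
- by apply: Ck_on_sub (sf k) => y [].
- by apply: Ck_on_sub (sg k) => y [].
Qed.

Lemma smooth_near_id E x : smooth_near (@id E) x.
Proof. by exists setT; [split=> //; exact: openT|exact: smooth_on_id]. Qed.

Lemma smooth_near_cst E F (c : F) (x : E) : smooth_near (fun=> c) x.
Proof. by exists setT; [split=> //; exact: openT|move=> k; exact: Ck_on_cst]. Qed.

Lemma smooth_near_linear E F (L : {linear E -> F}) x : smooth_near L x.
Proof.
exists setT; first by split=> //; exact: openT.
by move=> k; exact: (Ck_on_linear L openT (@smooth_on_id R E setT k)).
Qed.

Lemma smooth_near_comp_linear E F H (L : {linear F -> H}) (f : E -> F) x :
  smooth_near f x -> smooth_near (fun y => L (f y)) x.
Proof.
by move=> sf; apply: (smooth_near_comp (g := L)) => //; exact: smooth_near_linear.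
Qed.

Lemma smooth_nearZ E F (s : E -> R^o) (f : E -> F) x :
  smooth_near s x -> smooth_near f x -> smooth_near (fun y => s y *: f y) x.
Proof.
move=> [U [oU Ux] sf] [V [oV Vx] sg]; exists (U `&` V); first by split; [exact: openI|].
move=> k; apply: Ck_onZ; first exact: openI.
- by apply: Ck_on_sub (sf k) => y [].
- by apply: Ck_on_sub (sg k) => y [].
Qed.

Lemma smooth_nearD E F (f g : E -> F) x :
  smooth_near f x -> smooth_near g x -> smooth_near (fun y => f y + g y) x.
Proof.
move=> [U [oU Ux] sf] [V [oV Vx] sg]; exists (U `&` V); first by split; [exact: openI|].
move=> k; apply: Ck_onD; first exact: openI.
- by apply: Ck_on_sub (sf k) => y [].
- by apply: Ck_on_sub (sg k) => y [].
Qed.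

Lemma smooth_near_sum E F n (f : 'I_n -> E -> F) x :
  (forall i, smooth_near (f i) x) -> smooth_near (fun y => \sum_i f i y) x.
Proof.
elim: n f => [|n IH] f sf.
  apply: (@smooth_near_eq _ _ (fun=> 0)); last exact: smooth_near_cst.
  by apply: nearW => y; rewrite big_ord0.
apply: (@smooth_near_eq _ _ (fun y => f ord0 y + \sum_i f (lift ord0 i) y)).
  by apply: nearW => y; rewrite big_ord_recl.
by apply: smooth_nearD => //; exact: IH.
Qed.

(** The expansion of the first argument in coordinates reduces B to products of
    scalar functions with linear images of g. *)
Lemma smooth_near_bilinear E F F' H (B : F -> F' -> H) (f : E -> F) (g : E -> F') x :
  (forall w, linear (B ^~ w)) -> (forall v, linear (B v)) ->
  smooth_near f x -> smooth_near g x -> smooth_near (fun y => B (f y) (g y)) x.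
Proof.
move=> Bl Br sf sg.
apply: (@smooth_near_eq _ _ (fun y => \sum_i bcoord i (f y) *: B (bvect i) (g y))).
  apply: nearW => y; rewrite [f y in RHS]bcoordE.
  pose BM := GRing.isLinear.Build _ _ _ _ _ (Bl (g y)).
  pose L : {linear F -> H} := HB.pack (B ^~ (g y)) BM.
  rewrite -[RHS]/(L _) linear_sum; apply: eq_bigr => i _.
  by rewrite linearZ.
apply: smooth_near_sum => i; apply: smooth_nearZ.
  exact: (smooth_near_comp_linear (@bcoord R F i)).
pose BM := GRing.isLinear.Build _ _ _ _ _ (Br (bvect i)).
pose L : {linear F' -> H} := HB.pack (B (bvect i)) BM.
exact: (smooth_near_comp_linear L).
Qed.

Lemma diff_near_eq E F (f g : E -> F) (x : E) :
  (\near x, f x = g x) -> differentiable f x -> 'd f x = 'd g x :> (E -> F).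
Proof.
move=> fg df; have dg := near_eq_differentiable fg df.
by apply/funext => v; rewrite -!deriveE//; exact: near_eq_derive.
Qed.

End LocalSmooth.

Section SmoothMaps.
Variable R : realType.
Implicit Types E F H : normedVectType R.

Lemma near_csource E (M : manifold E) (c : chart M E) x (A : set M) :
  ctarget c x -> open A -> A (cfrom c x) -> \forall y \near x, A (cfrom c y).
Proof.
by move=> cx oA Ax; have := cfrom_continuous cx; apply; exact: near_open.
Qed.

Lemma transition_smooth_near E (M : manifold E) (c d : chart M E) x :
  atlas c -> atlas d -> ctarget c x -> csource d (cfrom c x) ->
  smooth_near (d \o cfrom c) x.
Proof.
move=> ac ad cx dx; apply: smooth_on_near (transition_smooth ac ad) => //.
exact: open_transition.
Qed.

(** Only the preferred charts at p and f p are used; [smooth_at_chart] passes to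
    arbitrary charts. *)
Definition smooth_at E F (M : manifold E) (N : manifold F) (f : M -> N) (p : M) :=
  {for p, continuous f} /\
  smooth_near (chart_at (f p) \o f \o cfrom (chart_at p)) (chart_at p p).

Variables (E F : normedVectType R) (M : manifold E) (N : manifold F).

(** Near x, the reading in (c, d) is the reading in the preferred charts, composed
    with transition maps on both sides. *)
Lemma smooth_at_chart (f : M -> N) (c : chart M E) (d : chart N F) x :
  atlas c -> atlas d -> ctarget c x -> csource d (f (cfrom c x)) ->
  smooth_at f (cfrom c x) -> smooth_near (d \o f \o cfrom c) x.
Proof.
move=> ac ad cx dx; set p := cfrom c x => -[cf sf].
pose c0 := chart_at p; pose d0 := chart_at (f p).
have pc0 : csource c0 p by exact: chart_at_source.
have pd0 : csource d0 (f p) by exact: chart_at_source.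
apply: (@smooth_near_eq _ _ _
    ((d \o cfrom d0) \o ((d0 \o f \o cfrom c0) \o (c0 \o cfrom c)))).
  have fd0 : \forall q \near p, csource d0 (f q).
    by apply: cf; apply: near_open => //; exact: csource_open.
  apply: filterS2 (near_csource cx (csource_open c0) pc0)
    (cfrom_continuous cx fd0) => y /= c0y d0y.
  by rewrite ctoK// ctoK.
have tc : smooth_near (c0 \o cfrom c) x.
  by apply: transition_smooth_near => //; exact: chart_at_atlas.
apply: smooth_near_comp; first by apply: smooth_near_comp.
rewrite /= ctoK//; apply: transition_smooth_near => //; first exact: chart_at_atlas.
  exact: cto_target.
by rewrite ctoK.
Qed.

Lemma smoothP (f : M -> N) : smooth f <-> forall p, smooth_at f p.
Proof.
split=> [[cf sf] p|sf].
  split; first exact: cf.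
  apply: smooth_on_near (sf _ _ (chart_at_atlas p) (chart_at_atlas (f p))).
    rewrite openE => x [cx dx]; apply: filterI.
      by apply: near_open => //; exact: ctarget_open.
    apply: (near_csource (A := f @^-1` csource (chart_at (f p)))) => //.
    by apply: open_comp => [? _|]; [exact: cf|exact: csource_open].
  split; first by apply: cto_target; exact: chart_at_source.
  by rewrite /= ctoK; exact: chart_at_source.
split=> [p|c d ac ad]; first by have [] := sf p.
by apply: smooth_on_of_near => x [cx dx]; exact: smooth_at_chart.
Qed.

End SmoothMaps.

(** * The tangent functor *)

Section TangentMap.
Variable R : realType.
Implicit Types E F H : normedVectType R.

(** The differential of the chart c at p, inverse to [chart_vector]. *)
Definition chart_covector E (M : manifold E) (c : chart M E) (p : M) : 'End(E) :=
  linfun ('d (c \o cfrom (chart_at p)) (chart_at p p)).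

Lemma tmapE E F (M : manifold E) (N : manifold F) (f : M -> N) p u :
  tmap f p u = 'd (chart_at (f p) \o f \o cfrom (chart_at p)) (chart_at p p) u.
Proof. by rewrite /tmap lfunE. Qed.

Lemma near_csource_comp E F (M : manifold E) (N : manifold F) (f : M -> N)
    (c : chart M E) (d : chart N F) x : ctarget c x ->
  {for cfrom c x, continuous f} -> csource d (f (cfrom c x)) ->
  \forall y \near x, csource d (f (cfrom c y)).
Proof.
move=> cx cf dx; have fd : \forall q \near cfrom c x, csource d (f q).
  by apply: cf; apply: near_open => //; exact: csource_open.
exact: (cfrom_continuous cx fd).
Qed.

Lemma chart_at_target E (M : manifold E) (p : M) : ctarget (chart_at p) (chart_at p p).
Proof. by apply: cto_target; exact: chart_at_source. Qed.

Lemma chart_atK E (M : manifold E) (p : M) : cfrom (chart_at p) (chart_at p p) = p.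
Proof. by apply: ctoK; exact: chart_at_source. Qed.

Lemma diff_chart_comp E F H (M : manifold E) (N : manifold F) (L : manifold H)
    (f : M -> N) (g : N -> L) (c : chart M E) (d : chart N F) (e : chart L H) x u :
  atlas c -> atlas d -> atlas e -> ctarget c x ->
  csource d (f (cfrom c x)) -> csource e (g (f (cfrom c x))) ->
  smooth_at f (cfrom c x) -> smooth_at g (f (cfrom c x)) ->
  'd (e \o (g \o f) \o cfrom c) x u =
  'd (e \o g \o cfrom d) (d (f (cfrom c x))) ('d (d \o f \o cfrom c) x u).
Proof.
move=> ac ad ae cx dx ex sf sg.
have sdf : smooth_near (d \o f \o cfrom c) x by exact: smooth_at_chart.
have seg : smooth_near (e \o g \o cfrom d) (d (f (cfrom c x))).
  by apply: smooth_at_chart; rewrite ?ctoK//; exact: cto_target.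
rewrite -[RHS]/(('d (e \o g \o cfrom d) ((d \o f \o cfrom c) x)
  \o 'd (d \o f \o cfrom c) x) u) -diff_comp; try exact: smooth_near_differentiable.
have nE : \forall y \near x, ((e \o g \o cfrom d) \o (d \o f \o cfrom c)) y =
    (e \o (g \o f) \o cfrom c) y.
  apply: filterS (near_csource_comp cx sf.1 dx) => y /= dy.
  by rewrite ctoK.
have dgf : differentiable ((e \o g \o cfrom d) \o (d \o f \o cfrom c)) x.
  by apply: differentiable_comp; exact: smooth_near_differentiable.
exact: (congr1 (fun h => h u) (esym (diff_near_eq nE dgf))).
Qed.

Lemma smooth_at_comp E F H (M : manifold E) (N : manifold F) (L : manifold H)
    (f : M -> N) (g : N -> L) p :
  smooth_at f p -> smooth_at g (f p) -> smooth_at (g \o f) p.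
Proof.
move=> sf sg; split; first by apply: continuous_comp; [exact: sf.1|exact: sg.1].
apply: (@smooth_near_eq _ _ _ ((chart_at (g (f p)) \o g \o cfrom (chart_at (f p)))
    \o (chart_at (f p) \o f \o cfrom (chart_at p)))).
  have := @near_csource_comp _ _ _ _ f (chart_at p) (chart_at (f p)) (chart_at p p).
  rewrite chart_atK => /(_ (chart_at_target p) sf.1 (chart_at_source _)).
  by apply: filterS => y /= dy; rewrite ctoK.
by apply: smooth_near_comp; [exact: sf.2|rewrite /= chart_atK; exact: sg.2].
Qed.

Lemma smooth_at_id E (M : manifold E) (p : M) : smooth_at id p.
Proof.
split; first exact: cvg_id.
apply: (@smooth_near_eq _ _ _ id); last exact: smooth_near_id.
have := near_open (@ctarget_open _ _ _ (chart_at p)) (chart_at_target p).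
by apply: filterS => y dy /=; rewrite cfromK.
Qed.

Lemma smooth_at_cst E F (M : manifold E) (N : manifold F) (q : N) (p : M) :
  smooth_at (fun=> q) p.
Proof.
split; first exact: cst_continuous.
exact: smooth_near_cst.
Qed.

Lemma tmap_comp E F H (M : manifold E) (N : manifold F) (L : manifold H)
    (f : M -> N) (g : N -> L) p u :
  smooth_at f p -> smooth_at g (f p) ->
  tmap (g \o f) p u = tmap g (f p) (tmap f p u).
Proof.
move=> sf sg; rewrite !tmapE.
rewrite (@diff_chart_comp _ _ _ _ _ _ f g (chart_at p) (chart_at (f p))) ?chart_atK//;
  by [exact: chart_at_atlas|exact: chart_at_target|exact: chart_at_source].
Qed.

Lemma tmap_id E (M : manifold E) (p : M) u : tmap id p u = u.
Proof.
rewrite tmapE -(@diff_near_eq _ _ _ id) ?diff_val//.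
have := near_open (@ctarget_open _ _ _ (chart_at p)) (chart_at_target p).
by apply: filterS => y dy /=; rewrite cfromK.
Qed.

Lemma tmap_cst E F (M : manifold E) (N : manifold F) (q : N) (p : M) u :
  tmap (fun=> q) p u = 0.
Proof.
rewrite tmapE (_ : _ \o _ = cst (chart_at q q)) ?diff_cst//.
Qed.

Lemma smooth_at_pair E F H (P : manifold H) (M : manifold E) (N : manifold F)
    (f : P -> M) (g : P -> N) p : smooth_at f p -> smooth_at g p ->
  smooth_at (fun z => (f z, g z) : prod_manifold M N) p.
Proof.
move=> [cf sf] [cg sg]; split; first exact: cvg_pair.
exact: smooth_near_pair sf sg.
Qed.

Lemma tmap_pair E F H (P : manifold H) (M : manifold E) (N : manifold F)
    (f : P -> M) (g : P -> N) p u : smooth_at f p -> smooth_at g p ->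
  tmap (fun z => (f z, g z) : prod_manifold M N) p u = (tmap f p u, tmap g p u).
Proof.
move=> [cf sf] [cg sg]; rewrite !tmapE.
exact: (congr1 (fun h => h u) (diff_pair (smooth_near_differentiable sf)
  (smooth_near_differentiable sg))).
Qed.

Section Projections.
Variables (E F : normedVectType R) (M : manifold E) (N : manifold F).

Let near_target (z : prod_manifold M N) :
  \forall x \near chart_at z z, ctarget (chart_at z) x.
Proof. by apply: near_open; [exact: ctarget_open|exact: chart_at_target]. Qed.

Lemma near_read_fst (z : prod_manifold M N) : \forall x \near chart_at z z,
  x.1 = (chart_at z.1 \o (fst : prod_manifold M N -> M) \o cfrom (chart_at z)) x.
Proof. by apply: filterS (near_target z) => -[x y] [/= cx _]; rewrite cfromK. Qed.

Lemma near_read_snd (z : prod_manifold M N) : \forall x \near chart_at z z,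
  x.2 = (chart_at z.2 \o (snd : prod_manifold M N -> N) \o cfrom (chart_at z)) x.
Proof. by apply: filterS (near_target z) => -[x y] [/= _ cy]; rewrite cfromK. Qed.

Lemma smooth_at_fst z : smooth_at (fst : prod_manifold M N -> M) z.
Proof.
split; first exact: cvg_fst.
by apply: smooth_near_eq (near_read_fst z) _; exact: smooth_near_linear.
Qed.

Lemma smooth_at_snd z : smooth_at (snd : prod_manifold M N -> N) z.
Proof.
split; first exact: cvg_snd.
by apply: smooth_near_eq (near_read_snd z) _; exact: smooth_near_linear.
Qed.

Lemma tmap_fst z w : tmap (fst : prod_manifold M N -> M) z w = w.1.
Proof.
have [dfst fstE] := @findim_is_diff R (E * F)%type E fst (chart_at z z).
by rewrite tmapE -(diff_near_eq (near_read_fst z))// fstE.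
Qed.

Lemma tmap_snd z w : tmap (snd : prod_manifold M N -> N) z w = w.2.
Proof.
have [dsnd sndE] := @findim_is_diff R (E * F)%type F snd (chart_at z z).
by rewrite tmapE -(diff_near_eq (near_read_snd z))// sndE.
Qed.

End Projections.

(** A tangent vector (u, v) of a product is (u, 0) + (0, v), a sum of velocities of
    the two slice inclusions. *)
Lemma tmap_partial E F H (M : manifold E) (N : manifold F) (L : manifold H)
    (f : prod_manifold M N -> L) (z : prod_manifold M N) (w : (E * F)%type) :
  smooth_at f z ->
  tmap f z w = tmap (fun x => f (x, z.2)) z.1 w.1 + tmap (fun y => f (z.1, y)) z.2 w.2.
Proof.
case: z w => p q [u v] sf /=.
pose i1 (x : M) : prod_manifold M N := (x, q).
pose i2 (y : N) : prod_manifold M N := (p, y).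
have s1 : smooth_at i1 p.
  by apply: smooth_at_pair; [exact: smooth_at_id|exact: smooth_at_cst].
have s2 : smooth_at i2 q.
  by apply: smooth_at_pair; [exact: smooth_at_cst|exact: smooth_at_id].
have t1 : tmap i1 p u = (u, 0).
  rewrite tmap_pair; [|exact: smooth_at_id|exact: smooth_at_cst].
  by rewrite tmap_id tmap_cst.
have t2 : tmap i2 q v = (0, v).
  rewrite tmap_pair; [|exact: smooth_at_cst|exact: smooth_at_id].
  by rewrite tmap_id tmap_cst.
have -> : tmap (fun x => f (x, q)) p u = tmap f (p, q) (u, 0).
  by rewrite -t1; exact: (tmap_comp (f := i1) (g := f)).
have -> : tmap (fun y => f (p, y)) q v = tmap f (p, q) (0, v).
  by rewrite -t2; exact: (tmap_comp (f := i2) (g := f)).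
rewrite -linearD; congr (tmap f _ _).
by rewrite -[RHS]/(u + 0, 0 + v) addr0 add0r.
Qed.

Section ChartVectors.
Variables (E : normedVectType R) (M : manifold E).

Lemma chart_vectorE (c : chart M E) x u :
  chart_vector c x u = 'd (chart_at (cfrom c x) \o cfrom c) x u.
Proof. by rewrite /chart_vector lfunE. Qed.

Lemma chart_vector_chart_at (p : M) u :
  chart_vector (chart_at p) (chart_at p p) u = u.
Proof. by rewrite chart_vectorE chart_atK -[RHS](tmap_id p) tmapE. Qed.

(** The chain rule through the preferred charts; it transports statements about
    [tmap] to any pair of charts. *)
Lemma diff_chart F (N : manifold F) (f : M -> N) (c : chart M E) (d : chart N F) x u :
  atlas c -> atlas d -> ctarget c x -> csource d (f (cfrom c x)) ->
  smooth_at f (cfrom c x) ->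
  'd (d \o f \o cfrom c) x u =
  chart_covector d (f (cfrom c x)) (tmap f (cfrom c x) (chart_vector c x u)).
Proof.
move=> ac ad cx dx sf; set p := cfrom c x.
have := @diff_chart_comp _ _ _ _ _ _ id f c (chart_at p) d x u.
move=> /(_ ac (chart_at_atlas p) ad cx (chart_at_source p) dx (smooth_at_id p) sf) ->.
have := @diff_chart_comp _ _ _ _ _ _ f id (chart_at p) (chart_at (f p)) d
  (chart_at p p) ('d (chart_at p \o id \o cfrom c) x u).
rewrite chart_atK => ->//; try by [exact: chart_at_atlas|exact: chart_at_target|
  exact: chart_at_source|exact: smooth_at_id].
by rewrite /chart_covector lfunE /= tmapE chart_vectorE.
Qed.

Lemma chart_covectorK (c : chart M E) p u : atlas c -> csource c p ->
  chart_vector c (c p) (chart_covector c p u) = u.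
Proof.
move=> ac cp.
have := @diff_chart_comp _ _ _ _ _ _ id id (chart_at p) c (chart_at p)
  (chart_at p p) u.
have e0 : 'd (chart_at p \o (id \o id) \o cfrom (chart_at p)) (chart_at p p) u = u.
  exact: etrans (esym (tmapE id p u)) (tmap_id p u).
rewrite e0 [cfrom (chart_at p) _]chart_atK => /(_ (chart_at_atlas p) ac (chart_at_atlas p)).
move=> /(_ (chart_at_target p) cp (chart_at_source p)).
move=> /(_ (smooth_at_id p) (smooth_at_id p)) {2}->.
by rewrite chart_vectorE ctoK// /chart_covector lfunE.
Qed.

End ChartVectors.
End TangentMap.

(** * One-forms and their exterior derivative *)

Section OneForms.
Variable R : realType.
Implicit Types E F H : normedVectType R.

Record is_form1 E (M : manifold E) (al : form1 M) : Prop := IsForm1 {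
  form1_linear : forall p, linear (al p : E -> R^o);
  form1_smooth : forall c, atlas c -> forall u,
    smooth_on (ctarget c) (fun x => local1 al c x u : R^o) }.

Definition pullback1 E F (M : manifold E) (N : manifold F) (f : M -> N)
    (al : form1 N) : form1 M :=
  fun p u => al (f p) (tmap f p u).

Lemma derive_sumr E F n (f : 'I_n -> E -> F) x v :
  (forall i, differentiable (f i) x) ->
  'D_v (fun y => \sum_i f i y) x = \sum_i 'D_v (f i) x.
Proof.
move=> df; rewrite (_ : (fun y => _) = \sum_i f i).
  by rewrite derive_sum// => i; exact: diff_derivable.
by apply/funext => y; rewrite fct_sumE.
Qed.

Lemma derive_scale E F (s : E -> R^o) (g : E -> F) x v :
  differentiable s x -> differentiable g x ->
  'D_v (fun y => s y *: g y) x = s x *: 'D_v g x + 'D_v s x *: g x.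
Proof.
move=> ds dg; have /differentiableP s_ := ds; have /differentiableP g_ := dg.
by have [dsg eq] := is_diff_scale s_ g_; rewrite deriveE// eq -!deriveE.
Qed.

Lemma derive_scale_cst E F (k : R) (g : E -> F) x v :
  differentiable g x -> 'D_v (fun y => k *: g y) x = k *: 'D_v g x.
Proof.
move=> dg; rewrite (derive_scale (s := cst k))//.
by rewrite derive_cst scale0r addr0.
Qed.

Lemma derive_linear_comb E F (k : R) (f g : E -> F) x v :
  differentiable f x -> differentiable g x ->
  'D_v (fun y => k *: f y + g y) x = k *: 'D_v f x + 'D_v g x.
Proof.
move=> df dg; have dkf : derivable (fun y => k *: f y) x v.
  by apply: diff_derivable; exact: differentiableZ.
rewrite -(derive_scale_cst k v df).
by rewrite -deriveD//; exact: diff_derivable.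
Qed.

Lemma derive_sub E F (f g : E -> F) x v :
  differentiable f x -> differentiable g x ->
  'D_v (fun y => f y - g y) x = 'D_v f x - 'D_v g x.
Proof. by move=> df dg; rewrite -deriveB//; exact: diff_derivable. Qed.

Lemma derive_linear_comp E F H (L : {linear F -> H}) (f : E -> F) x v :
  differentiable f x -> 'D_v (fun y => L (f y)) x = L ('D_v f x).
Proof.
move=> df; have [dL eL] := @findim_is_diff R F H L (f x).
rewrite -[fun y => L (f y)]/(L \o f) derive_comp// deriveE// eL//.
Qed.

Lemma bcoord_inj E (x y : E) : (forall i, bcoord i x = bcoord i y) -> x = y.
Proof.
by move=> xy; rewrite (bcoordE x) (bcoordE y); apply: eq_bigr => i _; rewrite xy.
Qed.

(** [derive_sym] for vector-valued maps, coordinate by coordinate. *)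
Lemma smooth_near_derive_sym E F (y : E -> F) x u v : smooth_near y x ->
  'D_u (fun x' => 'D_v y x') x = 'D_v (fun x' => 'D_u y x') x.
Proof.
move=> sy; apply: bcoord_inj => j.
have near_coord w : \forall x' \near x,
    'D_w (fun x => bcoord j (y x)) x' = bcoord j ('D_w y x').
  apply: filterS (near_smooth_near sy) => x' sy'.
  exact: (derive_linear_comp (@bcoord R F j) _ (smooth_near_differentiable sy')).
have sbD w : smooth_near (fun x' => 'D_w y x') x by exact: smooth_near_derive.
have coordDD w z : bcoord j ('D_w (fun x' => 'D_z y x') x) =
    'D_w (fun x' => 'D_z (fun x => bcoord j (y x)) x') x.
  rewrite (near_eq_derive w (near_coord z)); apply: esym.
  exact: (derive_linear_comp (@bcoord R F j) _ (smooth_near_differentiable (sbD z))).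
have [U [oU Ux] sU] := smooth_near_comp_linear (@bcoord R F j) sy.
have sym := derive_sym u v oU (sU 2%N) Ux.
exact: etrans (coordDD u v) (etrans sym (esym (coordDD v u))).
Qed.

Lemma local1_linear E (M : manifold E) (al : form1 M) c x :
  is_form1 al -> linear (local1 al c x : E -> R^o).
Proof. by move=> fa k u v; rewrite /local1 linearP form1_linear. Qed.

Lemma local1_bcoord E (M : manifold E) (al : form1 M) c x w : is_form1 al ->
  (local1 al c x w : R^o) = \sum_j bcoord j w *: (local1 al c x (bvect j) : R^o).
Proof.
move=> fa; have lin := local1_linear c x fa.
pose LM := GRing.isLinear.Build _ _ _ _ _ lin.
pose L : {linear E -> R^o} := HB.pack (local1 al c x : E -> R^o) LM.
rewrite -[LHS]/(L w) {1}[w]bcoordE linear_sum.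
by apply: eq_bigr => j _; rewrite linearZ.
Qed.

Lemma form1_smooth_near E (M : manifold E) (al : form1 M) c x u :
  is_form1 al -> atlas c -> ctarget c x ->
  smooth_near (fun x => local1 al c x u : R^o) x.
Proof.
move=> fa ac cx; apply: smooth_on_near (form1_smooth fa ac u) => //.
exact: ctarget_open.
Qed.

Section Naturality.
Variables (E F : normedVectType R) (M : manifold E) (N : manifold F).
Variables (f : M -> N) (al : form1 N).
Hypotheses (sf : smooth f) (fal : is_form1 al).

Let sfp p : smooth_at f p. Proof. by move: p; exact/smoothP. Qed.

(** In coordinates, f^* al is x |-> al_(y x) (D_u y x), where y is the reading of f. *)
Lemma local1_pullback (c : chart M E) (d : chart N F) x u :
  atlas c -> atlas d -> ctarget c x -> csource d (f (cfrom c x)) ->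
  local1 (pullback1 f al) c x u =
  local1 al d ((d \o f \o cfrom c) x) ('D_u (d \o f \o cfrom c) x).
Proof.
move=> ac ad cx dx; rewrite deriveE; last first.
  by apply: smooth_near_differentiable; exact: smooth_at_chart.
by rewrite diff_chart// /local1 /= ctoK// chart_covectorK.
Qed.

Section Charts.
Variables (c : chart M E) (d : chart N F) (x : E).
Hypotheses (ac : atlas c) (ad : atlas d) (cx : ctarget c x).
Hypothesis dx : csource d (f (cfrom c x)).

Let y := d \o f \o cfrom c.

Let sy : smooth_near y x. Proof. exact: smooth_at_chart. Qed.

Let dy : ctarget d (y x). Proof. exact: cto_target. Qed.

Let a j z : R^o := local1 al d z (bvect j).

Let sa j : smooth_near (a j) (y x). Proof. exact: form1_smooth_near. Qed.

Let local1_pullback_sum u : \forall x' \near x,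
  \sum_j bcoord j ('D_u y x') *: a j (y x') =
  (local1 (pullback1 f al) c x' u : R^o).
Proof.
have cont := (sfp (cfrom c x)).1.
apply: filterS2 (near_open (@ctarget_open _ _ _ c) cx)
  (near_csource_comp cx cont dx) => x' cx' dx'.
by rewrite (local1_pullback (d := d))// local1_bcoord.
Qed.

Lemma smooth_near_local1_pullback u :
  smooth_near (fun x => local1 (pullback1 f al) c x u : R^o) x.
Proof.
apply: smooth_near_eq (local1_pullback_sum u) _.
apply: smooth_near_sum => j; apply: smooth_nearZ.
  by apply: (smooth_near_comp_linear (@bcoord R F j)); exact: smooth_near_derive.
exact: (smooth_near_comp (g := a j)).
Qed.

(** The product rule for sum_j a_j (y x) * D_v y_j x.  The second term only involves
    second derivatives of y, so it is symmetric in u and v. *)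
Lemma derive_local1_pullback u v :
  'D_u (fun x => local1 (pullback1 f al) c x v : R^o) x =
  'D_('D_u y x) (fun z => local1 al d z ('D_v y x) : R^o) (y x) +
  \sum_j bcoord j ('D_u (fun x' => 'D_v y x') x) *: a j (y x).
Proof.
have sDy : smooth_near (fun x' => 'D_v y x') x by exact: smooth_near_derive.
have say j : smooth_near (fun x' => a j (y x')) x by exact: (smooth_near_comp (g := a j)).
have sb j : smooth_near (fun x' => bcoord j ('D_v y x')) x.
  exact: (smooth_near_comp_linear (@bcoord R F j)).
rewrite -(near_eq_derive u (local1_pullback_sum v)) derive_sumr; last first.
  by move=> j; apply: smooth_near_differentiable; exact: smooth_nearZ.
rewrite (_ : (fun z => (local1 al d z _ : R^o)) =
    fun z => \sum_j bcoord j ('D_v y x) *: a j z); last first.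
  by apply/funext => z; exact: local1_bcoord.
rewrite derive_sumr; last first.
  move=> j; apply: smooth_near_differentiable; apply: smooth_nearZ => //.
  exact: smooth_near_cst.
rewrite -big_split; apply: eq_bigr => j _.
have da := smooth_near_differentiable (sa j).
have e1 : 'D_u (fun x' => a j (y x')) x = 'D_('D_u y x) (a j) (y x).
  exact: (derive_comp (g := a j) u (smooth_near_differentiable sy) da).
have e2 : 'D_u (fun x' => bcoord j ('D_v y x')) x =
    bcoord j ('D_u (fun x' => 'D_v y x') x).
  exact: (derive_linear_comp (@bcoord R F j) _ (smooth_near_differentiable sDy)).
have e3 : 'D_('D_u y x) (fun z => bcoord j ('D_v y x) *: a j z) (y x) =
    bcoord j ('D_v y x) *: 'D_('D_u y x) (a j) (y x).
  exact: derive_scale_cst.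
rewrite e3 -e1 -e2.
exact: (derive_scale u (smooth_near_differentiable (sb j))
  (smooth_near_differentiable (say j))).
Qed.

(** The charts c and d are arbitrary: for preferred charts this is the naturality
    of d, and for f = id it is the independence of d from the chart. *)
Lemma ext_d1_pullback_chart u v :
  'D_u (fun x => local1 (pullback1 f al) c x v : R^o) x
  - 'D_v (fun x => local1 (pullback1 f al) c x u : R^o) x =
  'D_('D_u y x) (fun z => local1 al d z ('D_v y x) : R^o) (y x)
  - 'D_('D_v y x) (fun z => local1 al d z ('D_u y x) : R^o) (y x).
Proof.
rewrite (derive_local1_pullback u v) (derive_local1_pullback v u).
have cancelS (A B S S' : R^o) : S' = S -> A + S - (B + S') = A - B.
  by move=> ->; rewrite opprD addrACA subrr addr0.
apply: cancelS.
apply: eq_bigr => j _.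
exact: (congr1 (fun w => bcoord j w *: a j (y x)) (smooth_near_derive_sym v u sy)).
Qed.

End Charts.

Lemma is_form1_pullback : is_form1 (pullback1 f al).
Proof.
split=> [p k u v|c ac u]; first by rewrite /pullback1 linearP form1_linear.
apply: smooth_on_of_near => x cx.
apply: (smooth_near_local1_pullback (d := chart_at (f (cfrom c x)))) => //.
  exact: chart_at_atlas.
exact: chart_at_source.
Qed.

Lemma ext_d1_pullback p u v :
  ext_d1 (pullback1 f al) p u v = ext_d1 al (f p) (tmap f p u) (tmap f p v).
Proof.
pose y := chart_at (f p) \o f \o cfrom (chart_at p).
have dy : differentiable y (chart_at p p) by exact: smooth_near_differentiable (sfp p).2.
have Dy w : 'D_w y (chart_at p p) = tmap f p w by rewrite tmapE deriveE.
have yp : y (chart_at p p) = chart_at (f p) (f p) by rewrite /y /= chart_atK.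
have fp : csource (chart_at (f p)) (f (cfrom (chart_at p) (chart_at p p))).
  by rewrite chart_atK; exact: chart_at_source.
have := ext_d1_pullback_chart (chart_at_atlas p) (chart_at_atlas (f p))
  (chart_at_target p) fp u v.
by rewrite -/y (Dy u) (Dy v) yp.
Qed.

End Naturality.

Section ExteriorDerivative.
Variables (E : normedVectType R) (M : manifold E).
Implicit Types al be : form1 M.

Lemma smooth_id : smooth (@id M).
Proof. by apply/smoothP => p; exact: smooth_at_id. Qed.

(** Smoothness and closedness of d al concern its values at varying points, where
    [ext_d1] uses varying charts; this computes them in a single chart. *)
Lemma local2_ext_d1 al c x u v : is_form1 al -> atlas c -> ctarget c x ->
  local2 (ext_d1 al) c x u v =
  'D_u (fun x => local1 al c x v : R^o) x - 'D_v (fun x => local1 al c x u : R^o) x.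
Proof.
move=> fa ac cx; set p := cfrom c x.
have := ext_d1_pullback_chart smooth_id fa ac (chart_at_atlas p) cx
  (chart_at_source p) u v.
rewrite (_ : pullback1 id al = al); last first.
  by apply/funext => q; apply/funext => w; rewrite /pullback1 tmap_id.
move=> ->; rewrite /local2 /ext_d1 -/p !chart_vectorE.
rewrite -!deriveE//; apply: smooth_near_differentiable; apply: transition_smooth_near => //;
  by [exact: chart_at_atlas|exact: chart_at_source].
Qed.

Lemma is_form2_ext_d1 al : is_form1 al -> is_form2 (ext_d1 al).
Proof.
move=> fa; have sa p u := form1_smooth_near u fa (chart_at_atlas p) (chart_at_target p).
have da p u := smooth_near_differentiable (sa p u).
have locP c x k u u' : local1 al c x (k *: u + u') =
    k * local1 al c x u + local1 al c x u'.
  exact: local1_linear.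
have lin (k x1 x2 y1 y2 : R) : k * x1 + x2 - (k * y1 + y2) = k * (x1 - y1) + (x2 - y2).
  by ring.
pose A p w z : R := 'D_w (fun x => local1 al (chart_at p) x z : R^o) (chart_at p p).
have extE p u v : ext_d1 al p u v = A p u v - A p v u by [].
have Al p k w w' z : A p (k *: w + w') z = k * A p w z + A p w' z.
  by rewrite /A !deriveE// linearP.
have Ar p k w z z' : A p w (k *: z + z') = k * A p w z + A p w z'.
  have h := derive_linear_comb k w (da p z) (da p z').
  apply: etrans h; apply: near_eq_derive; apply: nearW => x.
  exact: locP.
split.
- move=> p v k u u'; rewrite !extE Al Ar; exact: lin.
- move=> p v k u u'; rewrite !extE Al Ar; exact: lin.
- by move=> p u; rewrite extE subrr.
move=> c ac u v; apply: smooth_on_of_near => x cx.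
apply: (@smooth_near_eq _ _ _ (fun x => 'D_u (fun x => local1 al c x v : R^o) x
  + (- 1) *: 'D_v (fun x => local1 al c x u : R^o) x)).
  apply: filterS (near_open (@ctarget_open _ _ _ c) cx) => x' cx'.
  by rewrite local2_ext_d1// scaleN1r.
apply: smooth_nearD; first by apply: smooth_near_derive; exact: form1_smooth_near.
apply: smooth_nearZ; first exact: smooth_near_cst.
by apply: smooth_near_derive; exact: form1_smooth_near.
Qed.

(** In a fixed chart, the six second derivatives of the coefficients of al cancel
    in pairs by symmetry. *)
Lemma closed_ext_d1 al : is_form1 al -> closed2 (ext_d1 al).
Proof.
move=> fa p u v w; rewrite /ext_d2; set c := chart_at p; set x := c p.
have ac : atlas c by exact: chart_at_atlas.
have cx : ctarget c x by exact: chart_at_target.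
pose a u' z : R^o := local1 al c z u'.
have sa u' : smooth_near (a u') x by exact: form1_smooth_near.
have locD u' v' w' : 'D_u' (fun z => local2 (ext_d1 al) c z v' w' : R^o) x =
    'D_u' (fun z => 'D_v' (a w') z) x - 'D_u' (fun z => 'D_w' (a v') z) x.
  have dD z z' : differentiable (fun x => 'D_z (a z') x) x.
    by apply: smooth_near_differentiable; exact: smooth_near_derive.
  apply: etrans (derive_sub _ (dD v' w') (dD w' v')); apply: near_eq_derive.
  apply: filterS (near_open (@ctarget_open _ _ _ c) cx) => z cz.
  exact: local2_ext_d1.
have sym u' v' w' : 'D_u' (fun z => 'D_v' (a w') z) x = 'D_v' (fun z => 'D_u' (a w') z) x.
  by have [U [oU Ux] sU] := sa w'; exact: derive_sym oU (sU 2%N) Ux.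
have alg (D : E -> E -> E -> R) : (forall u v w, D u v w = D v u w) ->
    D u v w - D u w v - (D v u w - D v w u) + (D w u v - D w v u) = 0.
  by move=> sD; rewrite (sD v u) (sD w u) (sD w v); ring.
have subst (x1 x2 x3 y1 y2 y3 : R) : x1 = y1 -> x2 = y2 -> x3 = y3 ->
    y1 - y2 + y3 = 0 -> x1 - x2 + x3 = 0 by move=> -> -> ->.
pose D u v w : R := 'D_u (fun z => 'D_v (a w) z) x.
exact: (subst _ _ _ _ _ _ (locD u v w) (locD v u w) (locD w u v) (alg D sym)).
Qed.

Lemma is_form1_opp al :
  is_form1 al -> is_form1 (fun p u => - al p u).
Proof.
move=> fa; split=> [p k u v|c ac u].
  by rewrite form1_linear// opprD scalerN.
apply: smooth_on_of_near => x cx.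
apply: (@smooth_near_eq _ _ _ (fun x => (-1 : R^o) *: (local1 al c x u : R^o))).
  by apply: near_all => y; rewrite scaleN1r.
by apply: smooth_nearZ; [exact: smooth_near_cst|exact: form1_smooth_near].
Qed.

Lemma ext_d1_opp al p u v :
  is_form1 al -> ext_d1 (fun p u => - al p u) p u v = - ext_d1 al p u v.
Proof.
move=> fa; set c := chart_at p.
have D w z : 'D_w (fun x => local1 (fun p u => - al p u) c x z : R^o) (c p) =
    -1 *: 'D_w (fun x => local1 al c x z : R^o) (c p).
  have da : differentiable (fun x => local1 al c x z : R^o) (c p).
    apply: smooth_near_differentiable; apply: form1_smooth_near => //.
      exact: chart_at_atlas.
    exact: chart_at_target.
  apply: etrans (derive_scale_cst (-1) w da); apply: near_eq_derive.
  by apply: near_all => y; rewrite scaleN1r.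
apply: (etrans (congr2 (fun s t : R => s - t) (D u v) (D v u))).
by rewrite !scaleN1r opprB opprK addrC.
Qed.

Lemma ext_d1D al be p u v :
  is_form1 al -> is_form1 be ->
  ext_d1 (fun p u => al p u + be p u) p u v = ext_d1 al p u v + ext_d1 be p u v.
Proof.
move=> fa fb; set c := chart_at p.
have d ga z : is_form1 ga -> differentiable (fun x => local1 ga c x z : R^o) (c p).
  move=> fg; apply: smooth_near_differentiable; apply: form1_smooth_near => //.
    exact: chart_at_atlas.
  exact: chart_at_target.
have D w z : 'D_w (fun x => local1 (fun p u => al p u + be p u) c x z : R^o) (c p) =
    1 *: 'D_w (fun x => local1 al c x z : R^o) (c p) +
    'D_w (fun x => local1 be c x z : R^o) (c p).
  apply: etrans (derive_linear_comb 1 w (d al z fa) (d be z fb)).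
  by apply: near_eq_derive; apply: near_all => y; rewrite scale1r.
apply: (etrans (congr2 (fun s t : R => s - t) (D u v) (D v u))).
by rewrite !scale1r opprD addrACA.
Qed.

End ExteriorDerivative.
End OneForms.

(** * The Maurer-Cartan form and the adjoint action *)

(* The values of derivatives are limits and choices: comparing two of them by
   unfolding is intractable, whereas their arguments compare at once. *)
Opaque diff derive tmap.

Section VectorValued.
Variable R : realType.
Implicit Types E F H : normedVectType R.

(** Continuity comes for free, since f is its reading composed with the chart. *)
Lemma smooth_at_vector E F (M : manifold E) (F_sc : @second_countable F)
    (f : M -> vector_manifold F_sc) p :
  smooth_near ((f : M -> F) \o cfrom (chart_at p)) (chart_at p p) -> smooth_at f p.
Proof.
move=> sf; split=> //.
have cfp : (f \o cfrom (chart_at p)) \o chart_at p @ p --> f p.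
  rewrite -[X in _ --> f X](chart_atK p).
  apply: (@continuous_comp _ _ _ (chart_at p) (f \o cfrom (chart_at p))).
    by apply: cto_continuous; exact: chart_at_source.
  exact: smooth_near_continuous sf.
apply: cvg_trans cfp; apply: near_eq_cvg.
apply: filterS (near_open (@csource_open _ _ _ (chart_at p)) (chart_at_source p)).
by move=> q cq /=; rewrite ctoK.
Qed.

Lemma chart_covector_chart_at E (M : manifold E) (p : M) u :
  chart_covector (chart_at p) p u = u.
Proof. by rewrite /chart_covector lfunE -[RHS](tmap_id p) tmapE. Qed.

Lemma tmap_point E F (M : manifold E) (N : manifold F) (f : M -> N) p q u :
  p = q -> tmap f p u = tmap f q u.
Proof. by move=> ->. Qed.

(** The right-hand side is a directional derivative of a fixed smooth map, hence
    smooth in (x, y): this is how [maurer_cartan] and [Ad] are shown to depend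
    smoothly on the group element.  The value l0 has to be fixed because the
    chart at the target is. *)
Lemma tmap_partial_chart E F H (M : manifold E) (N : manifold F) (L : manifold H)
    (f : prod_manifold M N -> L) (l0 : L) (c : chart M E) (d : chart N F) x y v :
  smooth f -> atlas c -> atlas d -> ctarget c x -> ctarget d y ->
  f (cfrom c x, cfrom d y) = l0 ->
  tmap (fun q => f (cfrom c x, q)) (cfrom d y) (chart_vector d y v) =
  'D_(0, v) (chart_at l0 \o f \o cfrom (prod_chart c d)) (x, y).
Proof.
move=> /smoothP sf ac ad cx dy fl0.
pose i2 q : prod_manifold M N := (cfrom c x, q).
have si2 : smooth_at i2 (cfrom d y).
  by apply: smooth_at_pair; [exact: smooth_at_cst|exact: smooth_at_id].
have sfi : smooth_at (f \o i2) (cfrom d y).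
  by apply: smooth_at_comp => //; exact: sf.
have l0s : csource (chart_at l0) ((f \o i2) (cfrom d y)).
  by rewrite /= /i2 fl0; exact: chart_at_source.
have cov l w : l = l0 -> chart_covector (chart_at l0) l w = w.
  by move=> ->; exact: chart_covector_chart_at.
transitivity ('d (chart_at l0 \o (f \o i2) \o cfrom d) y v).
  have D := diff_chart v ad (chart_at_atlas l0) dy l0s sfi.
  by rewrite D cov.
have apd : atlas (prod_chart c d : chart (prod_manifold M N) _) by exists (c, d).
have sH : smooth_near (chart_at l0 \o f \o cfrom (prod_chart c d)) (x, y).
  by apply: smooth_at_chart => //; exact: chart_at_atlas.
pose j y : (E * F)%type := (x, y).
have dj : is_diff y j (fun w => (0, w)).
  exact: (is_diff_pair (is_diff_cst x y) (is_diff_id y)).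
have Dj : 'D_v j y = (0, v) by rewrite deriveE// diff_val.
rewrite -Dj -(derive_comp (f := j) (g := chart_at l0 \o f \o cfrom (prod_chart c d)))//;
  last exact: smooth_near_differentiable.
rewrite deriveE//; apply: differentiable_comp; first by [].
exact: smooth_near_differentiable.
Qed.

End VectorValued.

Section LieGroupCalculus.
Variables (R : realType) (m : nat) (G : lie_group R m).
Local Notation "1" := (lg_one G).
Local Notation "x * y" := (lg_mul x y).
Local Notation "x ^-1" := (lg_inv x).

Lemma lg_mulgV (g : G) : g * g^-1 = 1.
Proof.
rewrite -[g * _](@lg_mul1 _ _ G) -{1}(lg_mulV (g^-1)) -lg_mulA.
by rewrite [g^-1 * _]lg_mulA lg_mulV lg_mul1 lg_mulV.
Qed.

Lemma lg_mulg1 (g : G) : g * 1 = g.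
Proof. by rewrite -(lg_mulV g) lg_mulA lg_mulgV lg_mul1. Qed.

Lemma lg_mulKg (g h : G) : g^-1 * (g * h) = h.
Proof. by rewrite lg_mulA lg_mulV lg_mul1. Qed.

Lemma lg_mulVKg (g h : G) : g * (g^-1 * h) = h.
Proof. by rewrite lg_mulA lg_mulgV lg_mul1. Qed.

Lemma lg_inv_uniq (g h : G) : g * h = 1 -> h = g^-1.
Proof. by move=> gh; rewrite -(lg_mulKg g h) gh lg_mulg1. Qed.

Lemma lg_invM (g h : G) : (g * h)^-1 = h^-1 * g^-1.
Proof.
by apply/esym/lg_inv_uniq; rewrite -lg_mulA [h * _]lg_mulA lg_mulgV lg_mul1 lg_mulgV.
Qed.

Lemma lg_invK (g : G) : g^-1^-1 = g.
Proof. by apply/esym/lg_inv_uniq; exact: lg_mulV. Qed.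

Lemma lg_inv1 : 1^-1 = 1 :> G.
Proof. by apply/esym/lg_inv_uniq; exact: lg_mul1. Qed.

Section SmoothOperations.
Variables (E : normedVectType R) (P : manifold E).

Lemma smooth_at_mul (h k : P -> G) p :
  smooth_at h p -> smooth_at k p -> smooth_at (fun z => h z * k z) p.
Proof.
move=> sh sk; have /smoothP sm := @lg_mul_smooth _ _ G.
exact: (smooth_at_comp (smooth_at_pair sh sk) (sm (h p, k p))).
Qed.

Lemma smooth_at_inv (h : P -> G) p : smooth_at h p -> smooth_at (fun z => (h z)^-1) p.
Proof.
move=> sh; have /smoothP si := @lg_inv_smooth _ _ G.
exact: (smooth_at_comp sh (si (h p))).
Qed.

End SmoothOperations.

Lemma smooth_at_mull (g h : G) : smooth_at (fun x : G => g * x) h.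
Proof. by apply: smooth_at_mul; [exact: smooth_at_cst|exact: smooth_at_id]. Qed.

Lemma smooth_at_conj (g h : G) : smooth_at (fun x : G => (g * x) * g^-1) h.
Proof. by apply: smooth_at_mul; [exact: smooth_at_mull|exact: smooth_at_cst]. Qed.

Lemma maurer_cartan_one X : maurer_cartan 1 X = X.
Proof.
rewrite /maurer_cartan (_ : (fun h => _) = id) ?tmap_id//.
by apply/funext => h; rewrite lg_inv1 lg_mul1.
Qed.

(** With h0 = h p and k0 = k p, left translation by the inverse of h0 k0 maps the
    product h z * k z to (k0^-1 (h0^-1 h z) k0) (k0^-1 k z); its derivative at p is
    the sum of the derivatives in h and in k. *)
Lemma maurer_cartan_mul (E : normedVectType R) (P : manifold E) (h k : P -> G) p u :
  smooth_at h p -> smooth_at k p ->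
  maurer_cartan (h p * k p) (tmap (fun z => h z * k z) p u) =
  Ad (k p)^-1 (maurer_cartan (h p) (tmap h p u)) + maurer_cartan (k p) (tmap k p u).
Proof.
move=> sh sk; set h0 := h p; set k0 := k p.
pose F (z : prod_manifold G G) : G := (h0 * k0)^-1 * (z.1 * z.2).
have sF : smooth_at F (h0, k0).
  apply: smooth_at_mul; first exact: smooth_at_cst.
  by apply: smooth_at_mul; [exact: smooth_at_fst|exact: smooth_at_snd].
have shk : smooth_at (fun z => h z * k z) p by exact: smooth_at_mul.
pose L (x : G) : G := (h0 * k0)^-1 * x.
pose hk (z : P) : prod_manifold G G := (h z, k z).
have e1 : maurer_cartan (h0 * k0) (tmap (fun z => h z * k z) p u) =
    tmap (L \o (fun z => h z * k z)) p u.
  exact: esym (tmap_comp (g := L) u shk (smooth_at_mull _ _)).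
have e2 : L \o (fun z => h z * k z) = F \o hk by apply/funext.
have e3 : tmap (F \o hk) p u = tmap F (h0, k0) (tmap h p u, tmap k p u).
  rewrite -(tmap_pair u sh sk).
  exact: (tmap_comp (f := hk) (g := F) u (smooth_at_pair sh sk) sF).
have e4 := tmap_partial (tmap h p u, tmap k p u) sF.
have e5 : (fun y => F (h0, y)) = (fun y : G => k0^-1 * y).
  by apply/funext => y; rewrite /F /= lg_invM -lg_mulA lg_mulKg.
have {}e5 : tmap (fun y => F (h0, y)) k0 (tmap k p u) = maurer_cartan k0 (tmap k p u).
  by rewrite e5.
apply: (etrans e1 (etrans (congr1 (fun w => tmap w p u) e2) (etrans e3 (etrans e4 _)))).
apply: (etrans (congr1 (fun w => _ + w) e5)); apply: (congr1 (fun w => w + _)).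
rewrite /Ad /maurer_cartan.
have -> : (fun x => F (x, k0)) =
    (fun x : G => (k0^-1 * x) * k0^-1^-1) \o (fun x : G => h0^-1 * x).
  by apply/funext => x; rewrite /F /= lg_invK lg_invM !lg_mulA.
have := tmap_comp (f := fun x : G => h0^-1 * x)
  (g := fun x : G => (k0^-1 * x) * k0^-1^-1) (tmap h p u)
  (smooth_at_mull _ h0) (smooth_at_conj _ _).
by rewrite lg_mulV.
Qed.

Lemma maurer_cartan_mull (E : normedVectType R) (P : manifold E) (g : G) (k : P -> G)
    p u : smooth_at k p ->
  maurer_cartan (g * k p) (tmap (fun z => g * k z) p u) =
  maurer_cartan (k p) (tmap k p u).
Proof.
move=> sk.
have e := maurer_cartan_mul (h := fun=> g) u (smooth_at_cst g p) sk.
have z : Ad (k p)^-1 (maurer_cartan g (tmap (fun=> g) p u)) = 0.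
  exact: etrans (congr1 (fun w => Ad _ (maurer_cartan g w)) (tmap_cst g p u))
    (etrans (congr1 (Ad _) (linear0 _)) (linear0 _)).
exact: etrans e (etrans (congr1 (fun w => w + _) z) (add0r _)).
Qed.

Lemma maurer_cartan_inj (g : G) u : maurer_cartan g u = 0 -> u = 0.
Proof.
move=> gu.
have e := tmap_comp (f := fun x : G => g^-1 * x) (g := fun x : G => g * x) u
  (smooth_at_mull _ g) (smooth_at_mull _ _).
have gV : (fun x : G => g * x) \o (fun x : G => g^-1 * x) = id.
  by apply/funext => x /=; rewrite lg_mulVKg.
rewrite -[LHS](tmap_id g) -gV; apply: (etrans e).
exact: etrans (congr1 _ gu) (linear0 _).
Qed.

(** Left translation by g is a section of the Maurer-Cartan form at g. *)
Lemma maurer_cartan_left (g : G) X :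
  maurer_cartan g (tmap (fun x : G => g * x) 1 X) = X.
Proof.
have e := maurer_cartan_mull (k := @id G) g X (smooth_at_id 1).
have e1 := etrans (congr1 (maurer_cartan 1) (tmap_id 1 X)) (maurer_cartan_one X).
have mcE h w : g = h -> maurer_cartan g w = maurer_cartan h w by move=> ->.
apply: etrans (mcE (g * 1) _ (esym (lg_mulg1 g))) _.
apply: (etrans e).
exact e1.
Qed.

Lemma Ad_one X : Ad 1 X = X.
Proof.
rewrite /Ad (_ : (fun h => _) = id) ?tmap_id//.
by apply/funext => h; rewrite lg_inv1 lg_mul1 lg_mulg1.
Qed.

Lemma Ad_mul (g h : G) X : Ad (g * h) X = Ad g (Ad h X).
Proof.
have e := tmap_comp (f := fun x : G => (h * x) * h^-1)
  (g := fun x : G => (g * x) * g^-1) X (smooth_at_conj h 1) (smooth_at_conj _ _).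
have gh : (fun x : G => (g * x) * g^-1) \o (fun x : G => (h * x) * h^-1) =
    (fun x : G => ((g * h) * x) * (g * h)^-1).
  by apply/funext => x /=; rewrite lg_invM !lg_mulA.
rewrite gh in e; apply: (etrans e).
by apply: tmap_point; rewrite lg_mulg1 lg_mulgV.
Qed.

End LieGroupCalculus.

(** * Coadjoint action, tautological form, one-parameter subgroups *)

Section PartialSmooth.
Variables (R : realType) (E F H : normedVectType R).
Variables (M : manifold E) (N : manifold F) (L : manifold H).

(** See [tmap_partial_chart]; y is the moving point of the second factor. *)
Lemma smooth_near_tmap_partial (f : prod_manifold M N -> L) (l0 : L)
    (c : chart M E) (d : chart N F) (y : E -> F) x v :
  smooth f -> atlas c -> atlas d -> ctarget c x -> smooth_near y x ->
  (forall x, ctarget c x -> ctarget d (y x)) ->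
  (forall x, ctarget c x -> f (cfrom c x, cfrom d (y x)) = l0) ->
  smooth_near (fun x => tmap (fun q => f (cfrom c x, q)) (cfrom d (y x))
    (chart_vector d (y x) v)) x.
Proof.
move=> sf ac ad cx sy dy fl0.
pose h := chart_at l0 \o f \o cfrom (prod_chart c d).
apply: (@smooth_near_eq _ _ _ (fun x => 'D_(0, v) h (x, y x))).
  apply: filterS (near_open (@ctarget_open _ _ _ c) cx) => x' cx'.
  by apply: esym; apply: tmap_partial_chart => //; [exact: dy|exact: fl0].
have sxy : smooth_near (fun x => (x, y x) : (E * F)%type) x.
  by apply: smooth_near_pair => //; exact: smooth_near_id.
apply: (smooth_near_comp (f := fun x => (x, y x)) (g := 'D_(0, v) h)) => //.
apply: smooth_near_derive; have /smoothP sfp := sf.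
have xy : ctarget (prod_chart c d) (x, y x) by split=> //; exact: dy.
apply: smooth_at_chart => //; [by exists (c, d)|exact: chart_at_atlas|].
have := chart_at_source l0; rewrite -{2}(fl0 x cx); exact.
Qed.

Lemma chart_vector_prod_fst (c : chart M E) (d : chart N F) z w :
  atlas c -> atlas d -> ctarget c z.1 -> ctarget d z.2 ->
  (chart_vector (prod_chart c d : chart (prod_manifold M N) _) z w).1 =
  chart_vector c z.1 w.1.
Proof.
case: z => x y /= ac ad cx dy; rewrite !chart_vectorE.
have dc : differentiable (chart_at (cfrom c x) \o cfrom c) x.
  apply: smooth_near_differentiable; apply: transition_smooth_near => //;
    by [exact: chart_at_atlas|exact: chart_at_source].
have dd : differentiable (chart_at (cfrom d y) \o cfrom d) y.
  apply: smooth_near_differentiable; apply: transition_smooth_near => //;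
    by [exact: chart_at_atlas|exact: chart_at_source].
have /differentiableP dc' := dc; have /differentiableP dd' := dd.
have dfst := @findim_is_diff R (E * F)%type E fst (x, y).
have dsnd := @findim_is_diff R (E * F)%type F snd (x, y).
have d1 := is_diff_comp dfst dc'; have d2 := is_diff_comp dsnd dd'.
have [_ e] := is_diff_pair d1 d2.
exact: (congr1 (fun h => (h w).1) e).
Qed.

End PartialSmooth.

Section Coadjoint.
Variables (R : realType) (m : nat) (G : lie_group R m).
Local Notation "1" := (lg_one G).
Local Notation "x * y" := (lg_mul x y).
Local Notation "x ^-1" := (lg_inv x).

Lemma pairing_linearl (X : 'rV[R]_m) : linear ((@pairing R m)^~ X : 'cV[R]_m -> R^o).
Proof. by move=> k xi xi'; rewrite /pairing mulmxDr -scalemxAr !mxE. Qed.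

Lemma pairing_linearr (xi : 'cV[R]_m) : linear (pairing xi : 'rV[R]_m -> R^o).
Proof. by move=> k X X'; rewrite /pairing mulmxDl -scalemxAl !mxE. Qed.

Lemma pairingDl (xi xi' : 'cV[R]_m) X :
  pairing (xi + xi') X = pairing xi X + pairing xi' X.
Proof. by rewrite /pairing mulmxDr mxE. Qed.

Lemma pairingDr (xi : 'cV[R]_m) X X' :
  pairing xi (X + X') = pairing xi X + pairing xi X'.
Proof. by rewrite /pairing mulmxDl mxE. Qed.

Lemma pairingZr k (xi : 'cV[R]_m) X : pairing xi (k *: X) = (k * pairing xi X)%R.
Proof. by rewrite /pairing -scalemxAl mxE. Qed.

Lemma pairing0l (X : 'rV[R]_m) : pairing 0 X = 0.
Proof. by rewrite /pairing mulmx0 mxE. Qed.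

Lemma pairing0r (xi : 'cV[R]_m) : pairing xi 0 = 0.
Proof. by rewrite /pairing mul0mx mxE. Qed.

Lemma pairing_delta (xi : 'cV[R]_m) i : pairing xi (delta_mx 0 i) = xi i 0.
Proof. by rewrite /pairing -rowE mxE. Qed.

Lemma pairing_inj (xi xi' : 'cV[R]_m) : pairing xi =1 pairing xi' -> xi = xi'.
Proof.
move=> e; apply/colP => i; rewrite -!pairing_delta; exact: e.
Qed.

Lemma coadjoint_one xi : coadjoint 1 xi = xi.
Proof.
by apply: pairing_inj => X; rewrite pairing_coadjoint lg_inv1 Ad_one.
Qed.

Lemma coadjoint_mul (g h : G) xi : coadjoint (g * h) xi = coadjoint g (coadjoint h xi).
Proof.
apply: pairing_inj => X.
apply: (etrans (pairing_coadjoint (g * h) xi X)); rewrite lg_invM.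
apply: (etrans (congr1 (pairing xi) (Ad_mul h^-1 g^-1 X))).
apply: (etrans (esym (pairing_coadjoint h xi _))).
exact: esym (pairing_coadjoint g _ X).
Qed.

Lemma smooth_conj_inv :
  smooth (fun z : prod_manifold G G => (z.1^-1 * z.2) * z.1^-1^-1).
Proof.
apply/smoothP => z; apply: smooth_at_mul.
  apply: smooth_at_mul; last exact: smooth_at_snd.
  by apply: smooth_at_inv; exact: smooth_at_fst.
by apply: smooth_at_inv; apply: smooth_at_inv; exact: smooth_at_fst.
Qed.

Lemma smooth_near_Ad_inv (c : chart G 'rV[R]_m) x X : atlas c -> ctarget c x ->
  smooth_near (fun x => Ad (cfrom c x)^-1 X) x.
Proof.
move=> ac cx; pose d := chart_at 1; pose y := d 1.
have sP := @smooth_near_tmap_partial _ _ _ _ _ _ _ _ 1 c d (fun=> y) x X smooth_conj_inv ac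
  (chart_at_atlas 1) cx (smooth_near_cst y x).
apply: smooth_near_eq (sP _ _).
- apply: near_all => x'.
  apply: (etrans (tmap_point _ _ (chart_atK 1))).
  exact: (congr1 (Ad (cfrom c x')^-1) (chart_vector_chart_at 1 X)).
- by move=> x' _; exact: chart_at_target.
- by move=> x' _; rewrite /= chart_atK lg_mulg1 lg_mulgV.
Qed.

Lemma smooth_near_maurer_cartan (c : chart G 'rV[R]_m) x u : atlas c -> ctarget c x ->
  smooth_near (fun x => maurer_cartan (cfrom c x) (chart_vector c x u)) x.
Proof.
move=> ac cx.
have sd : smooth (fun z : prod_manifold G G => z.1^-1 * z.2).
  apply/smoothP => z; apply: smooth_at_mul; last exact: smooth_at_snd.
  by apply: smooth_at_inv; exact: smooth_at_fst.
apply: (@smooth_near_tmap_partial _ _ _ _ _ _ _ _ 1 c c id x u sd ac ac cx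
  (smooth_near_id x)).
  by [].
by move=> x' _; exact: lg_mulV.
Qed.

Lemma smooth_near_pairing (E : normedVectType R) (xi : E -> 'cV[R]_m)
    (X : E -> 'rV[R]_m) x :
  smooth_near xi x -> smooth_near X x ->
  smooth_near (fun x => pairing (xi x) (X x) : R^o) x.
Proof.
exact: (@smooth_near_bilinear R E _ _ R^o (@pairing R m) xi X x
  pairing_linearl pairing_linearr).
Qed.

(** The entries of Ad^*_g xi are the pairings of xi with the vectors
    Ad_(g^-1) e_i, which are smooth in g. *)
Lemma coadjoint_is_action :
  is_action (N := dual_manifold R m) (@coadjoint R m G).
Proof.
split; [|exact: coadjoint_one|exact: coadjoint_mul].
apply/smoothP => -[g xi]; apply: smooth_at_vector.
pose S (z : 'rV[R]_m * 'cV[R]_m) : 'cV[R]_m :=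
  \sum_i (pairing z.2 (Ad (lg_inv (cfrom (chart_at g) z.1)) (delta_mx 0 i)) : R^o)
    *: (delta_mx i 0 : 'cV[R]_m).
have SE z : S z = coadjoint (cfrom (chart_at g) z.1) z.2.
  apply/colP => i; rewrite -[RHS]pairing_delta pairing_coadjoint summxE (bigD1 i)//=.
  rewrite !mxE !eqxx mulr1 big1 ?addr0// => j ji.
  by rewrite !mxE eq_sym (negbTE ji) mulr0.
have sS : smooth_near S (chart_at g g, xi).
  apply: smooth_near_sum => i; apply: smooth_nearZ; last exact: smooth_near_cst.
  apply: smooth_near_pairing; first exact: smooth_near_linear.
  apply: (smooth_near_comp (f := fst)
    (g := fun x => Ad (cfrom (chart_at g) x)^-1 (delta_mx 0 i))).
    exact: smooth_near_linear.
  by apply: smooth_near_Ad_inv; [exact: chart_at_atlas|exact: chart_at_target].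
exact: (smooth_near_eq (near_all _ SE) sS).
Qed.

Lemma tautologicalE (z : prod_manifold G (dual_manifold R m)) w :
  tautological G z w = pairing z.2 (maurer_cartan z.1 w.1).
Proof. by rewrite /tautological tmap_fst. Qed.

Lemma is_form1_tautological : is_form1 (tautological G).
Proof.
split=> [z k u v|_ [[c d] [/= ac ->] <-] u].
  by rewrite !tautologicalE linearP pairing_linearr.
apply: smooth_on_of_near => -[x xi] [/= cx _].
pose T (z : 'rV[R]_m * 'cV[R]_m) : R^o :=
  pairing z.2 (maurer_cartan (cfrom c z.1) (chart_vector c z.1 u.1)).
apply: (@smooth_near_eq _ _ _ T).
  have fo : \forall z \near (x, xi), ctarget c (z : 'rV[R]_m * 'cV[R]_m).1.
    have nc : nbhs x (ctarget c).
      by apply: open_nbhs_nbhs; split=> //; exact: ctarget_open.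
    exact: (@cvg_fst _ _ (nbhs x) (nbhs xi) _ _ nc).
  apply: filterS fo => -[x' xi'] /= cx'.
  rewrite /local1 tautologicalE.
  have e := @chart_vector_prod_fst R _ _ G (dual_manifold R m) c
    (id_chart _) (x', xi') u ac erefl cx' I.
  by rewrite e.
apply: smooth_near_pairing; first exact: smooth_near_linear.
apply: (smooth_near_comp (f := fst)
  (g := fun x => maurer_cartan (cfrom c x) (chart_vector c x u.1))).
  exact: smooth_near_linear.
exact: smooth_near_maurer_cartan.
Qed.

End Coadjoint.

Section Exponential.
Variables (R : realType) (m : nat) (G : lie_group R m) (expG : 'rV[R]_m -> G).
Hypothesis expGP : is_exponential expG.

Definition exp_curve X (t : real_line R) : G := expG ((t : R) *: X).

Lemma exp_curve_smooth_at X t : smooth_at (exp_curve X) t.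
Proof. by have [/smoothP s _ _] := expGP X; exact: s. Qed.

(** The neutral element is the only idempotent of a group. *)
Lemma exp_curve0 X : exp_curve X 0 = lg_one G.
Proof.
have [_ sM _] := expGP X; have := sM 0 0; rewrite addr0.
rewrite -/(exp_curve X 0) => /(congr1 (lg_mul (lg_inv (exp_curve X 0)))).
by rewrite lg_mulV lg_mulA lg_mulV lg_mul1 => <-.
Qed.

Lemma exp_curve_velocity X : tmap (exp_curve X) 0 1 = X.
Proof. by have [] := expGP X. Qed.

(** Since exp(sX) = exp(tX) exp((s - t)X), left invariance moves the velocity at
    t to the velocity at 0. *)
Lemma maurer_cartan_exp X (t : real_line R) (r : R) :
  maurer_cartan (exp_curve X t) (tmap (exp_curve X) t r) = r *: X.
Proof.
pose sh (s : real_line R) : real_line R := (s : R) - (t : R).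
have ssh : smooth_at sh t.
  apply: smooth_at_vector; apply: smooth_nearD; first exact: smooth_near_id.
  exact: smooth_near_cst.
have tsh : tmap sh t r = r.
  rewrite tmapE; have d1 : is_diff (t : R^o) (fun s : R^o => (s : R^o) + - (t : R^o)) id.
    have := is_diffD (is_diff_id (t : R^o)) (is_diff_cst (- (t : R^o)) (t : R^o)).
    by rewrite addr0.
  by have [_ e] := d1; exact: (congr1 (fun h => h r) e).
have sht : sh t = 0 by rewrite /sh subrr.
have sk : smooth_at (exp_curve X \o sh) t.
  by apply: smooth_at_comp => //; exact: exp_curve_smooth_at.
have e := maurer_cartan_mull (k := exp_curve X \o sh) (exp_curve X t) r sk.
have [_ sM _] := expGP X.
have eM s : lg_mul (exp_curve X t) ((exp_curve X \o sh) s) = exp_curve X s.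
  have ts : (t : R) + ((s : R) - (t : R)) = s by rewrite addrC subrK.
  exact: etrans (esym (sM (t : R) ((s : R) - (t : R)))) (congr1 (exp_curve X) ts).
have ec : (fun s => lg_mul (exp_curve X t) ((exp_curve X \o sh) s)) = exp_curve X.
  by apply/funext.
rewrite ec (eM t) in e; apply: (etrans e).
have e0 : (exp_curve X \o sh) t = lg_one G by rewrite /= sht exp_curve0.
have e1 := tmap_comp (f := sh) (g := exp_curve X) r ssh (exp_curve_smooth_at X _).
have mcE (h : G) w : h = lg_one G -> maurer_cartan h w = w.
  by move=> ->; exact: maurer_cartan_one.
apply: (etrans (mcE _ _ e0)); apply: (etrans e1).
apply: (etrans (tmap_point _ _ sht)); rewrite tsh.
have Z : tmap (exp_curve X) 0 (r *: (1 : R^o)) = r *: tmap (exp_curve X) 0 1.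
  by rewrite linearZ.
apply: (etrans _ (etrans Z (congr1 (fun w => r *: w) (exp_curve_velocity X)))).
by congr (tmap (exp_curve X) 0 _); rewrite -[RHS]/(r * 1)%R mulr1.
Qed.

End Exponential.

(** * Actions and their groupoids *)

Section Actions.
Variables (R : realType) (m : nat) (G : lie_group R m).
Variables (E : normedVectType R) (N : manifold E) (a : G -> N -> N).
Hypothesis aP : is_action a.
Local Notation "1" := (lg_one G).

Lemma smooth_at_action (F : normedVectType R) (P : manifold F)
    (g : P -> G) (q : P -> N) p :
  smooth_at g p -> smooth_at q p -> smooth_at (fun z => a (g z) (q z)) p.
Proof.
move=> sg sq; have /smoothP sa := action_smooth aP.
exact: (smooth_at_comp (smooth_at_pair sg sq) (sa (g p, q p))).
Qed.

Lemma smooth_at_orbit p g : smooth_at (fun x => a x p) g.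
Proof. by apply: smooth_at_action; [exact: smooth_at_id|exact: smooth_at_cst]. Qed.

Lemma smooth_at_translation g p : smooth_at (a g) p.
Proof. by apply: smooth_at_action; [exact: smooth_at_cst|exact: smooth_at_id]. Qed.

(** The map X |-> rho(X)_p, see [generating_inf_action]; unlike [generating], it is
    linear by construction. *)
Definition inf_action (p : N) : 'Hom('rV[R]_m, E) := tmap (fun g => a g p) 1.

Lemma actionK g : cancel (a g) (a (lg_inv g)).
Proof. by move=> p; rewrite -(action_mul aP) lg_mulV (action_one aP). Qed.

Lemma tmap_translationK g p v : tmap (a (lg_inv g)) (a g p) (tmap (a g) p v) = v.
Proof.
have e := tmap_comp (f := a g) (g := a (lg_inv g)) v (smooth_at_translation g p)
  (smooth_at_translation _ _).
have gK : a (lg_inv g) \o a g = id by apply/funext; exact: actionK.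
rewrite gK in e; apply: (etrans (esym e)); exact: tmap_id.
Qed.

(** Differentiate a(x, p) = a_g (a(g^-1 x, p)) at x = g. *)
Lemma tmap_orbit g p u :
  tmap (fun x => a x p) g u = tmap (a g) p (inf_action p (maurer_cartan g u)).
Proof.
have e1 := tmap_comp (f := fun x => lg_mul (lg_inv g) x) (g := fun x => a x p) u
  (smooth_at_mull _ g) (smooth_at_orbit _ _).
have e2 := tmap_comp (f := (fun x => a x p) \o (fun x => lg_mul (lg_inv g) x))
  (g := a g) u (smooth_at_comp (smooth_at_mull _ g) (smooth_at_orbit _ _))
  (smooth_at_translation _ _).
have e3 : a g \o ((fun x => a x p) \o (fun x => lg_mul (lg_inv g) x)) = (fun x => a x p).
  by apply/funext => x /=; rewrite -(action_mul aP) lg_mulVKg.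
rewrite e3 in e2; apply: (etrans e2).
have e4 : ((fun x => a x p) \o (fun x => lg_mul (lg_inv g) x)) g = p.
  by rewrite /= lg_mulV (action_one aP).
apply: (etrans (tmap_point _ _ e4)); apply: (congr1 (tmap (a g) p)).
apply: (etrans e1); exact: tmap_point (lg_mulV g).
Qed.

Lemma tmap_action (z : prod_manifold G N) w :
  tmap (fun z : prod_manifold G N => a z.1 z.2) z w =
  tmap (a z.1) z.2 (inf_action z.2 (maurer_cartan z.1 w.1) + w.2).
Proof.
have sa : smooth_at (fun z : prod_manifold G N => a z.1 z.2) z.
  by apply: smooth_at_action; [exact: smooth_at_fst|exact: smooth_at_snd].
apply: (etrans (tmap_partial w sa)); rewrite linearD.
apply: (congr1 (fun v => v + _)); exact: tmap_orbit.
Qed.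

Lemma generating_inf_action expG X p : is_exponential expG ->
  generating expG a X p = inf_action p X.
Proof.
move=> expGP; have s0 := exp_curve_smooth_at expGP X 0.
have e := tmap_comp (f := exp_curve expG X) (g := fun x => a x p) (1%R : R^o) s0
  (smooth_at_orbit _ _).
apply: (etrans e); apply: (etrans (tmap_point _ _ (exp_curve0 expGP X))).
by apply: (congr1 (inf_action p)); exact: exp_curve_velocity.
Qed.

Lemma action_groupoid_is_lie_groupoid : is_lie_groupoid (action_groupoid a).
Proof.
have sa z : smooth_at (fun z : prod_manifold G N => a z.1 z.2) z.
  by apply: smooth_at_action; [exact: smooth_at_fst|exact: smooth_at_snd].
split.
- by apply/smoothP => z; exact: smooth_at_snd.
- by apply/smoothP => z; exact: sa.
- apply/smoothP => z.
  by apply: smooth_at_pair; [exact: smooth_at_cst|exact: smooth_at_id].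
- apply/smoothP => z; apply: smooth_at_pair; last exact: sa.
  by apply: smooth_at_inv; exact: smooth_at_fst.
- by move=> j v; exists (0, v); exact: tmap_snd.
(* The target map is already a submersion along M, where it is the diffeomorphism
   a_g. *)
- move=> [g p] v; exists (0, tmap (a (lg_inv g)) (a g p) v).
  apply: (etrans (tmap_action (g, p) _)) => /=; rewrite !linear0 add0r.
  by have := tmap_translationK (lg_inv g) (a g p) v; rewrite actionK lg_invK.
- move=> F P h k /smoothP sh /smoothP sk hk; apply/smoothP => z.
  have sf1 : smooth_at (fun z => (h z).1) z.
    exact: (smooth_at_comp (sh z) (@smooth_at_fst _ _ _ G N (h z))).
  have sk1 : smooth_at (fun z => (k z).1) z.
    exact: (smooth_at_comp (sk z) (@smooth_at_fst _ _ _ G N (k z))).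
  have sk2 : smooth_at (fun z => (k z).2) z.
    exact: (smooth_at_comp (sk z) (@smooth_at_snd _ _ _ G N (k z))).
  by apply: smooth_at_pair => //; exact: smooth_at_mul.
- by [].
- by move=> p; exact: action_one.
- by [].
- by move=> [g p] [h q] /= ->; rewrite -(action_mul aP).
- by move=> [g p] [h q] [k r] _ _ /=; rewrite /gmul /= lg_mulA.
- by move=> [g p] /=; rewrite /gmul /= lg_mul1.
- by move=> [g p] /=; rewrite /gmul /= lg_mulg1.
- by [].
- by move=> [g p] /=; exact: actionK.
- by move=> [g p] /=; rewrite /gmul /ginv /= lg_mulV.
- by move=> [g p] /=; rewrite /gmul /ginv /= lg_mulgV.
Qed.

End Actions.

(** * The tautological form along a two-parameter family *)

Section CanonicalForm.
Variables (R : realType) (m : nat) (G : lie_group R m) (expG : 'rV[R]_m -> G).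
Hypothesis expGP : is_exponential expG.
Local Notation coad := (@coadjoint R m G).
Local Notation dual := (dual_manifold R m).
Local Notation TG := (prod_manifold G dual).

Let coadP : is_action (N := dual) coad := coadjoint_is_action G.

(** The parameter space R x R x g^* of the family [strip_map]. *)
Definition strip : manifold (R^o * R^o * 'cV[R]_m)%type :=
  prod_manifold (prod_manifold (real_line R) (real_line R)) dual.

Lemma strip_read (z : strip) (F : normedVectType R) (f : strip -> F) :
  f \o cfrom (chart_at z) = f.
Proof. by apply/funext => -[[s t] xi]. Qed.

Lemma strip_chart_vector (z : strip) x u : chart_vector (chart_at z) x u = u.
Proof.
rewrite chart_vectorE.
have -> : chart_at (cfrom (chart_at z) x) \o cfrom (chart_at z) = id.
  by apply/funext => -[[s t] xi].
by have [_ ->] := is_diff_id x.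
Qed.

Lemma strip_local1 (al : form1 strip) (z : strip) x u :
  local1 al (chart_at z) x u = al x u.
Proof.
rewrite /local1 strip_chart_vector.
by rewrite (_ : cfrom _ x = x)//; case: x => -[].
Qed.

Section Strip.
Variables (g : G) (X Y : 'rV[R]_m).

Definition strip_left (z : strip) : G := lg_mul g (exp_curve expG X z.1.1).

Definition strip_group (z : strip) : G :=
  lg_mul (strip_left z) (exp_curve expG Y z.1.2).

(** (s, t, xi) |-> (g exp(sX) exp(tY), xi).  At (0, 0, xi) its velocities in the
    directions d/ds + eta and d/dt + eta' are arbitrary tangent vectors of the
    cotangent groupoid, for suitable X and Y. *)
Definition strip_map (z : strip) : TG := (strip_group z, z.2).

Let time1 (z : strip) : real_line R := z.1.1.
Let time2 (z : strip) : real_line R := z.1.2.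

Let sfst z : smooth_at (fst : strip -> prod_manifold (real_line R) (real_line R)) z.
Proof. exact: smooth_at_fst. Qed.

Let stime1 z : smooth_at time1 z.
Proof. exact: (smooth_at_comp (sfst z) (smooth_at_fst z.1)). Qed.

Let stime2 z : smooth_at time2 z.
Proof. exact: (smooth_at_comp (sfst z) (smooth_at_snd z.1)). Qed.

Let ttime1 z w : tmap time1 z w = w.1.1.
Proof.
apply: (etrans (tmap_comp w (sfst z) (smooth_at_fst z.1))).
by apply: (etrans (tmap_fst _ _)); rewrite tmap_fst.
Qed.

Let ttime2 z w : tmap time2 z w = w.1.2.
Proof.
apply: (etrans (tmap_comp w (sfst z) (smooth_at_snd z.1))).
by apply: (etrans (tmap_snd _ _)); rewrite tmap_fst.
Qed.

Let sexp1 z : smooth_at (exp_curve expG X \o time1) z.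
Proof. by apply: smooth_at_comp => //; exact: exp_curve_smooth_at. Qed.

Let sexp2 z : smooth_at (exp_curve expG Y \o time2) z.
Proof. by apply: smooth_at_comp => //; exact: exp_curve_smooth_at. Qed.

Let sleft z : smooth_at strip_left z.
Proof. by apply: smooth_at_mul; [exact: smooth_at_cst|exact: sexp1]. Qed.

Let sgroup z : smooth_at strip_group z.
Proof. by apply: smooth_at_mul; [exact: sleft|exact: sexp2]. Qed.

Lemma strip_map_smooth : smooth strip_map.
Proof.
by apply/smoothP => z; apply: smooth_at_pair; [exact: sgroup|exact: smooth_at_snd].
Qed.

(** exp(sX) and exp(tY) have constant logarithmic derivatives X and Y; only the
    factor exp(sX) is twisted, by its right neighbour exp(tY). *)
Lemma maurer_cartan_strip z w :
  maurer_cartan (strip_group z) (tmap strip_group z w) =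
  Ad (lg_inv (exp_curve expG Y z.1.2)) (w.1.1 *: X) + w.1.2 *: Y.
Proof.
apply: (etrans (maurer_cartan_mul w (sleft z) (sexp2 z))).
have e1 : maurer_cartan (strip_left z) (tmap strip_left z w) = w.1.1 *: X.
  apply: (etrans (maurer_cartan_mull g w (sexp1 z))).
  have e := tmap_comp w (stime1 z) (exp_curve_smooth_at expGP X _).
  apply: (etrans (congr1 (maurer_cartan _) e)).
  by apply: (etrans (maurer_cartan_exp expGP X _ _)); rewrite ttime1.
have e2 : maurer_cartan (exp_curve expG Y (time2 z))
    (tmap (exp_curve expG Y \o time2) z w) = w.1.2 *: Y.
  have e := tmap_comp w (stime2 z) (exp_curve_smooth_at expGP Y _).
  apply: (etrans (congr1 (maurer_cartan _) e)).
  by apply: (etrans (maurer_cartan_exp expGP Y _ _)); rewrite ttime2.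
apply: (etrans (congr1 (fun v => Ad _ v + _) e1)).
exact: (congr1 (fun v => _ + v) e2).
Qed.

Lemma tautological_strip z w : pullback1 strip_map (tautological G) z w =
  w.1.1 * pairing (coad (exp_curve expG Y z.1.2) z.2) X + w.1.2 * pairing z.2 Y.
Proof.
have e : tmap strip_map z w =
    (tmap strip_group z w, tmap (snd : strip -> dual) z w).
  exact: (tmap_pair w (sgroup z) (smooth_at_snd z)).
rewrite /pullback1 e tautologicalE /=.
apply: (etrans (congr1 (pairing z.2) (maurer_cartan_strip z w))).
by rewrite pairingDr !pairingZr linearZ /= pairingZr pairing_coadjoint.
Qed.

Let coad_strip (z : strip) : dual := coad (exp_curve expG Y z.1.2) z.2.

Let scoad z : smooth_at coad_strip z.
Proof. by apply: (smooth_at_action coadP); [exact: sexp2|exact: smooth_at_snd]. Qed.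

Let tcoad xi (eta : 'cV[R]_m) : tmap coad_strip ((0, 0), xi) ((0, 1), eta) =
  inf_action (N := dual) coad xi Y + eta.
Proof.
pose z0 : strip := ((0, 0), xi).
pose q (z : strip) : TG := (exp_curve expG Y z.1.2, z.2).
have sq : smooth_at q z0 by apply: smooth_at_pair; [exact: sexp2|exact: smooth_at_snd].
have /smoothP sc := action_smooth coadP.
apply: (etrans (tmap_comp _ sq (sc _))).
have tq : tmap q z0 ((0, 1), eta) =
    (tmap (exp_curve expG Y \o time2) z0 ((0, 1), eta), eta).
  apply: (etrans (tmap_pair _ (sexp2 z0) (smooth_at_snd z0))).
  by apply: (congr1 (pair _)); exact: tmap_snd.
have te : tmap (exp_curve expG Y \o time2) z0 ((0, 1), eta) = Y.
  apply: (etrans (tmap_comp _ (stime2 z0) (exp_curve_smooth_at expGP Y _))).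
  by apply: (etrans (congr1 (tmap _ _) (ttime2 z0 _))); exact: exp_curve_velocity.
rewrite tq te.
have q0 : q z0 = (lg_one G, xi) by rewrite /q /= exp_curve0.
apply: (etrans (tmap_point _ _ q0)).
apply: (etrans (tmap_action coadP (lg_one G, xi) (Y, eta))) => /=.
have c1 : coad (lg_one G) = id by apply/funext; exact: coadjoint_one.
rewrite c1 maurer_cartan_one; exact: tmap_id.
Qed.

(** The coefficient <xi, Y> of dt is linear in xi.  The coefficient of ds,
    <Ad^*_(exp tY) xi, X>, is differentiated along d/dt + eta', which yields the
    infinitesimal coadjoint action of Y. *)
Lemma ext_d1_strip xi eta eta' :
  ext_d1 (pullback1 strip_map (tautological G)) ((0, 0), xi)
    ((1, 0), eta) ((0, 1), eta') =
  pairing eta Y - pairing eta' X - pairing (inf_action (N := dual) coad xi Y) X.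
Proof.
pose z0 : strip := ((0, 0), xi).
pose LX : {linear 'cV[R]_m -> R^o} := HB.pack (fun xi => pairing xi X : R^o)
  (GRing.isLinear.Build _ _ _ _ _ (@pairing_linearl R m X)).
pose LY : {linear 'cV[R]_m -> R^o} := HB.pack (fun xi => pairing xi Y : R^o)
  (GRing.isLinear.Build _ _ _ _ _ (@pairing_linearl R m Y)).
have e1 : (fun x => local1 (pullback1 strip_map (tautological G)) (chart_at z0) x
    ((0, 1), eta') : R^o) = (fun x => LY x.2).
  apply/funext => x; rewrite strip_local1 tautological_strip /=.
  by rewrite mul0r add0r mul1r.
have e2 : (fun x => local1 (pullback1 strip_map (tautological G)) (chart_at z0) x
    ((1, 0), eta) : R^o) = (fun x => LX (coad_strip x)).
  apply/funext => x; rewrite strip_local1 tautological_strip /=.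
  by rewrite mul0r addr0 mul1r.
have [dsnd sndE] := @findim_is_diff R (R^o * R^o * 'cV[R]_m)%type 'cV[R]_m snd
  (chart_at z0 z0).
have d1 : 'D_((1, 0), eta) (fun x => LY x.2) (chart_at z0 z0) = pairing eta Y.
  apply: (etrans (derive_linear_comp LY _ dsnd)); rewrite deriveE//.
  by rewrite sndE.
have [_ sc] := scoad z0.
have d2 : 'D_((0, 1), eta') (fun x => LX (coad_strip x)) (chart_at z0 z0) =
    pairing (inf_action (N := dual) coad xi Y + eta') X.
  have dc : differentiable (coad_strip : _ -> 'cV[R]_m) (chart_at z0 z0).
    have := smooth_near_differentiable sc.
    by rewrite -[X in differentiable X _](strip_read z0).
  apply: (etrans (derive_linear_comp LX _ dc)).
  apply: (congr1 (fun v => pairing v X)); apply: etrans (tcoad xi eta').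
  rewrite deriveE// tmapE.
  by rewrite -[in LHS](strip_read z0 coad_strip).
rewrite /ext_d1 e1 e2.
apply: (etrans (congr2 (fun s t : R => s - t) d1 d2)).
have -> : pairing (inf_action (N := dual) coad xi Y + eta') X =
    pairing (inf_action (N := dual) coad xi Y) X + pairing eta' X.
  exact: pairingDl.
by rewrite opprD addrA addrAC.
Qed.

End Strip.
End CanonicalForm.

(** * The symplectic groupoid structure on the cotangent bundle *)

Section SymplecticGroupoid.
Variables (R : realType) (m : nat) (G : lie_group R m) (expG : 'rV[R]_m -> G).
Hypothesis expGP : is_exponential expG.
Local Notation coad := (@coadjoint R m G).
Local Notation dual := (dual_manifold R m).
Local Notation TG := (prod_manifold G dual).

Let coadP : is_action (N := dual) coad := coadjoint_is_action G.

(** Both tangent vectors are velocities of [strip_map] for X = mc u and Y = mc u'.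
    The formula avoids the Lie bracket: the last term is - <xi, [Y, X]>. *)
Lemma omega_canE (g : G) (xi : 'cV[R]_m) u eta u' eta' :
  omega_can G (g, xi) (u, eta) (u', eta') =
  pairing eta' (maurer_cartan g u) - pairing eta (maurer_cartan g u') +
  pairing (inf_action (N := dual) coad xi (maurer_cartan g u')) (maurer_cartan g u).
Proof.
set X := maurer_cartan g u; set Y := maurer_cartan g u'.
pose z0 : strip R m := ((0, 0), xi).
pose f := strip_map expG g X Y.
have sg0 : strip_group expG g X Y z0 = g.
  rewrite /strip_group /strip_left.
  by rewrite (exp_curve0 expGP X) (exp_curve0 expGP Y) !lg_mulg1.
have f0 : f z0 = (g, xi) by rewrite /f /strip_map sg0.
have mcE (h : G) v : h = g -> maurer_cartan h v = maurer_cartan g v by move=> ->.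
have mcI v v' : maurer_cartan g v = maurer_cartan g v' -> v = v'.
  move=> vv'; apply/eqP; rewrite -subr_eq0; apply/eqP.
  by apply: (@maurer_cartan_inj _ _ _ g); rewrite linearB /= vv' subrr.
have tf (w : (R^o * R^o * 'cV[R]_m)%type) v :
    Ad (lg_inv (exp_curve expG Y 0)) (w.1.1 *: X) + w.1.2 *: Y =
      maurer_cartan g v ->
    tmap f z0 w = (v, w.2).
  move=> wv.
  have sg : smooth_at (strip_group expG g X Y) z0.
    have /smoothP sf := strip_map_smooth expGP g X Y.
    exact: (smooth_at_comp (sf z0) (smooth_at_fst (f z0))).
  have e : tmap f z0 w =
      (tmap (strip_group expG g X Y) z0 w, tmap (snd : strip R m -> dual) z0 w).
    exact: (tmap_pair (M := G) (N := dual) w sg (smooth_at_snd z0)).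
  apply: (etrans e); apply: (congr2 pair); last exact: tmap_snd.
  apply: mcI; apply: (etrans (esym (mcE _ _ sg0))).
  by apply: etrans wv; exact: maurer_cartan_strip.
have e1 : Ad (lg_inv (exp_curve expG Y 0)) ((1 : R) *: X) + (0 : R) *: Y = X.
  by rewrite (exp_curve0 expGP Y) lg_inv1 Ad_one scale1r scale0r addr0.
have tfX := tf ((1, 0), eta) u e1.
have e2 : Ad (lg_inv (exp_curve expG Y 0)) ((0 : R) *: X) + (1 : R) *: Y = Y.
  by rewrite scale0r linear0 add0r scale1r.
have tfY := tf ((0, 1), eta') u' e2.
have e := ext_d1_pullback (strip_map_smooth expGP g X Y) (is_form1_tautological G)
  z0 ((1, 0), eta) ((0, 1), eta').
have extE p w w' : p = (g, xi) ->
    ext_d1 (tautological G) p w w' = ext_d1 (tautological G) (g, xi) w w' by move=> ->.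
have e3 := etrans e (congr2 (ext_d1 (tautological G) (f z0)) tfX tfY).
have e4 := etrans e3 (extE _ _ _ f0).
have e5 := etrans (esym e4) (ext_d1_strip expGP g X Y xi eta eta').
apply: (etrans (congr1 -%R e5)).
by rewrite opprB [LHS]addrC opprB.
Qed.

(** Pairing with the vertical vectors (0, eta') forces mc u = 0, hence u = 0; then
    pairing with all (v, 0) forces eta = 0. *)
Lemma omega_can_symplectic : symplectic (omega_can G).
Proof.
have ft := is_form1_tautological G; have fn := is_form1_opp ft.
have oE : omega_can G = ext_d1 (fun p u => - tautological G p u).
  apply/funext => p; apply/funext => u; apply/funext => v.
  by rewrite (ext_d1_opp _ _ _ ft).
split; rewrite ?oE.
- exact: is_form2_ext_d1.
- exact: closed_ext_d1.
rewrite -oE => -[g xi] [u eta] w0.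
have u0 : u = 0.
  apply: (@maurer_cartan_inj _ _ _ g); apply/rowP => i; rewrite mxE.
  have := w0 (0, delta_mx i 0).
  rewrite omega_canE !linear0 pairing0r pairing0l subr0 addr0 => <-.
  by rewrite /pairing -colE mxE.
rewrite u0; congr (_, _); apply: pairing_inj => X; rewrite pairing0l.
have [v vX] : exists v, maurer_cartan g v = X.
  by exists (tmap (fun x : G => lg_mul g x) (lg_one G) X); exact: maurer_cartan_left.
have := w0 (v, 0); rewrite omega_canE u0 vX !linear0 pairing0l pairing0r sub0r addr0.
by move/eqP; rewrite oppr_eq0 => /eqP.
Qed.

(** The tautological form itself is multiplicative: in <xi, mc (gh)> the product
    rule produces Ad_(h^-1), which composability moves to the other side of the
    pairing as the coadjoint action of h. *)
Lemma omega_can_multiplicative (F : normedVectType R) (P : manifold F)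
    (h k : P -> TG) z u v :
  smooth h -> smooth k -> (forall z, (h z).2 = coad (k z).1 (k z).2) ->
  pullback2 (fun z => (lg_mul (h z).1 (k z).1, (k z).2) : TG) (omega_can G) z u v =
  pullback2 h (omega_can G) z u v + pullback2 k (omega_can G) z u v.
Proof.
move=> sh sk hk; have /smoothP shp := sh; have /smoothP skp := sk.
pose f z : TG := (lg_mul (h z).1 (k z).1, (k z).2).
have sh1 z' : smooth_at (fun z => (h z).1) z'.
  exact: (smooth_at_comp (shp z') (@smooth_at_fst _ _ _ G dual (h z'))).
have sk1 z' : smooth_at (fun z => (k z).1) z'.
  exact: (smooth_at_comp (skp z') (@smooth_at_fst _ _ _ G dual (k z'))).
have sk2 z' : smooth_at (fun z => (k z).2) z'.
  exact: (smooth_at_comp (skp z') (@smooth_at_snd _ _ _ G dual (k z'))).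
have sm z' : smooth_at (fun z => lg_mul (h z).1 (k z).1) z' by exact: smooth_at_mul.
have sf : smooth f by apply/smoothP => z'; exact: smooth_at_pair.
have th1 z' w : tmap (fun z => (h z).1) z' w = (tmap h z' w).1.
  apply: (etrans (tmap_comp w (shp z') (@smooth_at_fst _ _ _ G dual (h z')))).
  exact: tmap_fst.
have tk1 z' w : tmap (fun z => (k z).1) z' w = (tmap k z' w).1.
  apply: (etrans (tmap_comp w (skp z') (@smooth_at_fst _ _ _ G dual (k z')))).
  exact: tmap_fst.
have ft := is_form1_tautological G.
have fE : pullback1 f (tautological G) =
    (fun z u => pullback1 h (tautological G) z u + pullback1 k (tautological G) z u).
  apply/funext => z'; apply/funext => w; rewrite /pullback1 !tautologicalE.
  have tf : tmap f z' w = (tmap (fun z => lg_mul (h z).1 (k z).1) z' w,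
      tmap (fun z => (k z).2) z' w) by exact: tmap_pair.
  have tm := maurer_cartan_mul w (sh1 z') (sk1 z').
  apply: (etrans (congr1 (fun w => pairing (k z').2 (maurer_cartan (f z').1 w.1)) tf)).
  apply: (etrans (congr1 (pairing (k z').2) tm)); rewrite pairingDr.
  apply: (congr2 (fun s t : R => s + t)); last first.
    exact: (congr1 (fun w => pairing (k z').2 (maurer_cartan (k z').1 w)) (tk1 z' w)).
  apply: (etrans (esym (pairing_coadjoint (k z').1 (k z').2 _))).
  apply: (congr2 (@pairing R m) (esym (hk z'))).
  exact: (congr1 (maurer_cartan (h z').1) (th1 z' w)).
rewrite /pullback2 /omega_can -opprD; congr (- _).
apply: (etrans (esym (ext_d1_pullback sf ft z u v))).
rewrite fE ext_d1D; [|exact: is_form1_pullback|exact: is_form1_pullback].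
by apply: (congr2 (fun s t : R => s + t)); exact: ext_d1_pullback.
Qed.

Lemma cotangent_symplectic_groupoid :
  symplectic_groupoid (K := cotangent_groupoid G) (omega_can G).
Proof.
split; first exact: action_groupoid_is_lie_groupoid coadP.
  exact: omega_can_symplectic.
move=> F P h k sh sk hk z u v; exact: omega_can_multiplicative.
Qed.

End SymplecticGroupoid.

(** * Linear algebra of 2-forms and of the action algebroid *)

(** [lfunE] for a function that is only proved to be linear. *)
Lemma linear_linfunE (R : fieldType) (aT rT : vectType R) (f : aT -> rT) u :
  linear f -> linfun f u = f u.
Proof.
move=> fl; pose LM := GRing.isLinear.Build _ _ _ _ _ fl.
pose L : {linear aT -> rT} := HB.pack f LM.
by rewrite -[f in linfun f]/(L : aT -> rT) lfunE.
Qed.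

Section FormAlgebra.
Variables (R : realType) (E : normedVectType R) (M : manifold E) (om : form2 M).
Hypothesis fo : is_form2 om.

Lemma form2Dl p u u' v : om p (u + u') v = om p u v + om p u' v.
Proof. by have := form2_linearl fo p v 1 u u'; rewrite !scale1r. Qed.

Lemma form2Dr p u v v' : om p u (v + v') = om p u v + om p u v'.
Proof. by have := form2_linearr fo p u 1 v v'; rewrite !scale1r. Qed.

Lemma form20l p v : om p 0 v = 0.
Proof. by apply: (addrI (om p 0 v)); rewrite -form2Dl !addr0. Qed.

Lemma form2_antisym p u v : om p u v = - om p v u.
Proof.
apply/eqP; rewrite -subr_eq0 opprK; apply/eqP.
have := form2_alternating fo p (u + v).
by rewrite form2Dl !form2Dr !(form2_alternating fo) add0r addr0.
Qed.

End FormAlgebra.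

Lemma row_linear_sum (R : realType) n (h : 'rV[R]_n -> R^o) u : linear h ->
  h u = \sum_j u 0 j * h (delta_mx 0 j).
Proof.
move=> hl; pose HM := GRing.isLinear.Build _ _ _ _ _ hl.
pose L : {linear 'rV[R]_n -> R^o} := HB.pack h HM.
rewrite -[h]/(L : _ -> _) {1}[u]row_sum_delta linear_sum.
by apply: eq_bigr => j _; rewrite linearZ.
Qed.

(** Nondegeneracy makes v |-> om_p (v, _) injective, and the dimensions agree. *)
Lemma form2_surjective (R : realType) n (M : manifold 'rV[R]_n) (om : form2 M) p
    (al : 'Hom('rV[R]_n, R^o)) :
  symplectic om -> exists v, forall u, om p v u = al u.
Proof.
move=> so; have fo := symplectic_form so.
pose f (v : 'rV[R]_n) : 'rV[R]_n := \row_j om p v (delta_mx 0 j).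
have fl : linear f.
  by move=> k u v; apply/rowP => j; rewrite !mxE (form2_linearl fo).
have omE v u : om p v u = \sum_j u 0 j * f v 0 j.
  rewrite (row_linear_sum u (form2_linearr fo p v)).
  by apply: eq_bigr => j _; rewrite mxE.
pose F : 'End('rV[R]_n) := linfun f.
have FE v : F v = f v by exact: linear_linfunE.
have F0 : lker F == 0%VS.
  apply/lker0P => v v' vv'.
  have f0 : f (v - v') = 0 by rewrite -FE linearB /= vv' subrr.
  apply/eqP; rewrite -subr_eq0; apply/eqP; apply: (symplectic_nondegenerate so (p := p)).
  by move=> u; rewrite omE f0 big1// => j _; rewrite mxE mulr0.
pose b : 'rV[R]_n := \row_j al (delta_mx 0 j).
exists ((F^-1)%VF b) => u; rewrite omE -FE lker0_lfunVK//.
have all : linear (al : 'rV[R]_n -> R^o) by move=> k w w'; rewrite linearP.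
rewrite [RHS](row_linear_sum u all).
by apply: eq_bigr => j _; rewrite mxE.
Qed.

Section ActionAlgebroid.
Variables (R : realType) (m : nat) (G : lie_group R m).
Variables (E : normedVectType R) (N : manifold E) (b : G -> N -> N).
Hypothesis bP : is_action b.
Local Notation A p := (@lie_algebroid R _ _ (action_groupoid b) p).

(** The algebroid of an action groupoid is spanned by the vectors (X, 0) at the
    units, so its fibre is the Lie algebra; [algebroid_vec] is this identification. *)
Lemma algebroid_mem (p : N) X : (X, 0) \in A p.
Proof. by rewrite memv_ker; apply/eqP; exact: tmap_snd. Qed.

Lemma algebroid_vsval (p : N) (w : subvs_of (A p)) : vsval w = ((vsval w).1, 0).
Proof.
have := subvsP w; rewrite memv_ker => /eqP w0.
rewrite [LHS]surjective_pairing; congr (_, _); apply: etrans w0.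
by apply: esym; exact: tmap_snd.
Qed.

Lemma algebroid_vsval_linear (p : N) k (w w' : subvs_of (A p)) :
  (vsval (k *: w + w')).1 = k *: (vsval w).1 + (vsval w').1.
Proof. by rewrite linearP. Qed.

Definition algebroid_vec (p : N) X : subvs_of (A p) := vsproj (A p) (X, 0).

Lemma algebroid_vecE p X : vsval (algebroid_vec p X) = (X, 0).
Proof. by rewrite vsprojK// algebroid_mem. Qed.

Lemma algebroid_vec_inj p (w w' : subvs_of (A p)) :
  (vsval w).1 = (vsval w').1 -> w = w'.
Proof.
by move=> ww'; apply: subvs_inj; rewrite (algebroid_vsval w) (algebroid_vsval w') ww'.
Qed.

Lemma algebroid_vec_linear p k X X' :
  algebroid_vec p (k *: X + X') = k *: algebroid_vec p X + algebroid_vec p X'.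
Proof. by apply: algebroid_vec_inj; rewrite algebroid_vsval_linear !algebroid_vecE. Qed.

Lemma algebroid_dE (p : N) (w : subvs_of (A p)) :
  algebroid_d (J := action_groupoid b) w = - inf_action b p (vsval w).1.
Proof.
congr (- _); apply: (etrans (tmap_action bP (lg_one G, p) (vsval w))) => /=.
have b1 : b (lg_one G) = id by apply/funext; exact: (action_one bP).
rewrite b1 maurer_cartan_one; apply: (etrans (tmap_id p _)).
by rewrite {2}(algebroid_vsval w) /= addr0.
Qed.

End ActionAlgebroid.

(** * The moment map as a Lagrangian morphism *)

Section HamiltonianAction.
Variables (R : realType) (m n : nat) (G : lie_group R m).
Variables (expG : 'rV[R]_m -> G) (M : manifold 'rV[R]_n) (om : form2 M).
Variables (a : G -> M -> M) (mu : M -> dual_manifold R m).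
Hypothesis expGP : is_exponential expG.
Hypothesis ham : hamiltonian_action expG om a mu.
Local Notation coad := (@coadjoint R m G).
Local Notation dual := (dual_manifold R m).
Local Notation TG := (prod_manifold G dual).
Local Notation J := (action_groupoid a).
Local Notation K := (cotangent_groupoid G).

Definition moment_functor (z : prod_manifold G M) : TG := (z.1, mu z.2).

Let aP : is_action a := ham_action ham.
Let coadP : is_action (N := dual) coad := coadjoint_is_action G.
Let fo : is_form2 om := symplectic_form (ham_symplectic ham).

Let smu p : smooth_at mu p.
Proof. by move: p; apply/smoothP; exact: ham_moment_smooth ham. Qed.

Lemma moment_pairing p v X : pairing (tmap mu p v) X = - om p (inf_action a p X) v.
Proof.
by rewrite (ham_moment ham) (generating_inf_action aP _ _ expGP).
Qed.

(** Infinitesimal equivariance of the moment map. *)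
Lemma moment_inf_action p X :
  inf_action (N := dual) coad (mu p) X = tmap mu p (inf_action a p X).
Proof.
have e : (fun g => coad g (mu p)) = mu \o (fun g => a g p).
  by apply/funext => g /=; rewrite (ham_equivariant ham).
rewrite /inf_action e.
apply: (etrans (tmap_comp X (smooth_at_orbit aP p _) (smu _))).
exact: tmap_point (action_one aP p).
Qed.

Let sPhi1 z : smooth_at (fst : prod_manifold G M -> G) z.
Proof. exact: smooth_at_fst. Qed.

Let sPhi2 z : smooth_at (fun z : prod_manifold G M => mu z.2) z.
Proof. by apply: (smooth_at_comp (smooth_at_snd z)); exact: smu. Qed.

Lemma moment_functor_smooth : smooth moment_functor.
Proof. by apply/smoothP => z; exact: smooth_at_pair. Qed.

Lemma tmap_moment_functor z w : tmap moment_functor z w = (w.1, tmap mu z.2 w.2).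
Proof.
apply: (etrans (tmap_pair w (sPhi1 z) (sPhi2 z))).
apply: (congr2 pair); first exact: tmap_fst.
apply: (etrans (tmap_comp w (smooth_at_snd z) (smu z.2))).
by apply: (congr1 (tmap mu z.2)); exact: tmap_snd.
Qed.

Lemma moment_functor_morphism :
  is_lie_groupoid_morphism (J := J) (K := K) moment_functor mu.
Proof.
split.
- exact: moment_functor_smooth.
- exact: ham_moment_smooth ham.
- by [].
- by move=> [g p]; exact: esym (ham_equivariant ham g p).
- by [].
- by [].
Qed.

(** Both sides equal - om (v, rho(Y)) - om (rho(X), v') - om (rho(X), rho(Y)). *)
Lemma pullback_omega_can j w w' :
  pullback2 moment_functor (omega_can G) j w w' = groupoid_delta (J := J) om j w w'.
Proof.
case: j w w' => g p [u v] [u' v'].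
have eL : pullback2 moment_functor (omega_can G) (g, p) (u, v) (u', v') =
    omega_can G (g, mu p) (u, tmap mu p v) (u', tmap mu p v').
  apply: (congr2 (omega_can G (g, mu p))); exact: tmap_moment_functor.
set X := maurer_cartan g u; set Y := maurer_cartan g u'.
have e1 : pullback2 (src J) om (g, p) (u, v) (u', v') = om p v v'.
  by apply: (congr2 (om p)); exact: tmap_snd.
have e2 : pullback2 (tgt J) om (g, p) (u, v) (u', v') =
    om p (inf_action a p X + v) (inf_action a p Y + v').
  apply: etrans (ham_invariant ham g p _ _).
  by apply: (congr2 (om (a g p))); exact: (tmap_action aP (g, p)).
apply: (etrans eL); apply: (etrans (omega_canE expGP _ _ _ _ _ _)).
apply: etrans (esym (congr2 (fun s t : R => s - t) e1 e2)).
rewrite moment_inf_action !moment_pairing -/X -/Y.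
rewrite !(form2Dl fo) !(form2Dr fo) (form2_antisym fo p (inf_action a p Y) v).
by ring.
Qed.

Lemma moment_isotropic :
  isotropic_structure (J := J) (K := K) moment_functor (omega_can G) om.
Proof.
split; first exact: fo.
  exact: pullback_omega_can.
exact: symplectic_closed (ham_symplectic ham).
Qed.

Section Fibre.
Variable p : M.
Local Notation AJ := (lie_algebroid J p).
Local Notation AK := (lie_algebroid K (mu p)).

Lemma tmap_unit (xi : dual) eta : tmap (gunit K) xi eta = (0, eta).
Proof.
apply: (etrans (tmap_pair eta (smooth_at_cst (lg_one G) xi) (smooth_at_id xi))).
by apply: (congr2 pair); [exact: tmap_cst|exact: tmap_id].
Qed.

Lemma omega_can_unitr X (eta : 'cV[R]_m) :
  omega_can G (lg_one G, mu p) (X, 0) (0, eta) = pairing eta X.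
Proof.
rewrite (omega_canE expGP) !maurer_cartan_one.
by rewrite linear0 !pairing0l subr0 addr0.
Qed.

Lemma omega_can_unitl X (eta : 'cV[R]_m) :
  omega_can G (lg_one G, mu p) (0, eta) (X, 0) = - pairing eta X.
Proof.
rewrite (omega_canE expGP) !maurer_cartan_one.
by rewrite !pairing0r sub0r addr0.
Qed.

Lemma tmap_moment_algebroid (w : subvs_of AJ) :
  tmap moment_functor (lg_one G, p) (vsval w) = ((vsval w).1, 0).
Proof.
apply: (etrans (tmap_moment_functor _ _)); apply: (congr1 (pair _)).
apply: etrans (linear0 (tmap mu p)); apply: (congr1 (tmap mu p)).
by rewrite algebroid_vsval.
Qed.

Lemma algebroid_functor (w : subvs_of AJ) :
  vsproj AK (tmap moment_functor (lg_one G, p) (vsval w)) =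
  algebroid_vec (N := dual) coad (mu p) (vsval w).1.
Proof.
by apply: (congr1 (vsproj AK)); exact: tmap_moment_algebroid.
Qed.

Let map0 (vW : 'rV[R]_n * subvs_of AK) u : R^o :=
  - om p vW.1 u + omega_can G (lg_one G, mu p) (vsval vW.2)
    (tmap (gunit K) (mu p) (tmap mu p u)).

Let map0E vW u : map0 vW u = - om p (vW.1 + inf_action a p (vsval vW.2).1) u.
Proof.
rewrite /map0 (algebroid_vsval vW.2) tmap_unit omega_can_unitr moment_pairing.
by rewrite (form2Dl fo) opprD.
Qed.

Let map1 (eta : 'cV[R]_m) (w : subvs_of AJ) : R^o :=
  omega_can G (lg_one G, mu p) (tmap (gunit K) (mu p) eta)
    (tmap moment_functor (lg_one G, p) (vsval w)).

Let map1E eta w : map1 eta w = - pairing eta (vsval w).1.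
Proof.
by rewrite /map1 tmap_unit tmap_moment_algebroid omega_can_unitl.
Qed.

Let hom0 vW : 'Hom('rV[R]_n, R^o) := linfun (map0 vW).

Let hom0E vW u : hom0 vW u = - om p (vW.1 + inf_action a p (vsval vW.2).1) u.
Proof.
rewrite /hom0 linear_linfunE ?map0E// => k v w.
by rewrite !map0E (form2_linearr fo) opprD scalerN.
Qed.

Let hom1 eta : 'Hom(subvs_of AJ, R^o) := linfun (map1 eta).

Let hom1E eta w : hom1 eta w = - pairing eta (vsval w).1.
Proof.
rewrite /hom1 linear_linfunE ?map1E// => k v v'.
by rewrite !map1E algebroid_vsval_linear (pairing_linearr eta) opprD scalerN.
Qed.

Let dual_d (al : 'Hom('rV[R]_n, R^o)) : 'Hom(subvs_of AJ, R^o) :=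
  linfun (fun w : subvs_of AJ => - al (algebroid_d w) : R^o).

Let dual_dE al w : dual_d al w = al (inf_action a p (vsval w).1).
Proof.
rewrite /dual_d linear_linfunE ?algebroid_dE// ?linearN ?opprK// => k v v'.
by rewrite !(algebroid_dE aP) !linearN !opprK algebroid_vsval_linear !linearP.
Qed.

Let normal_dm1 (w : subvs_of AJ) : 'rV[R]_n * subvs_of AK :=
  (algebroid_d w, vsproj AK (tmap moment_functor (lg_one G, p) (vsval w))).

Let normal_dm1E w : normal_dm1 w =
  (- inf_action a p (vsval w).1, algebroid_vec (N := dual) coad (mu p) (vsval w).1).
Proof. by rewrite /normal_dm1 algebroid_functor algebroid_dE. Qed.

Let normal_d0 (vW : 'rV[R]_n * subvs_of AK) : 'cV[R]_m :=
  tmap mu p vW.1 - algebroid_d vW.2.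

Let normal_d0E vW : normal_d0 vW = tmap mu p (vW.1 + inf_action a p (vsval vW.2).1).
Proof.
rewrite /normal_d0 (algebroid_dE coadP) opprK moment_inf_action linearD.
exact: erefl.
Qed.

(* The sum v + rho(W) is what both the differential and the comparison map see. *)
Let total_linear k (vW vW' : ('rV[R]_n * subvs_of AK)%type) :
  (k *: vW + vW').1 + inf_action a p (vsval (k *: vW + vW').2).1 =
  k *: (vW.1 + inf_action a p (vsval vW.2).1) + (vW'.1 + inf_action a p (vsval vW'.2).1).
Proof.
have -> : (vsval (k *: vW + vW').2).1 = k *: (vsval vW.2).1 + (vsval vW'.2).1.
  exact: algebroid_vsval_linear.
have -> x y : inf_action a p (k *: x + y) = k *: inf_action a p x + inf_action a p y.
  by rewrite linearP.
by rewrite -[LHS]/(k *: vW.1 + vW'.1 + _) scalerDr addrACA.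
Qed.

Let normal_d0_linear : linear normal_d0.
Proof.
have muP k x y : tmap mu p (k *: x + y) = k *: tmap mu p x + tmap mu p y.
  by rewrite linearP.
by move=> k vW vW'; rewrite !normal_d0E -muP total_linear.
Qed.

Let dual_d_linear : linear dual_d.
Proof.
move=> k al be; apply/lfunP => w.
by rewrite add_lfunE scale_lfunE !dual_dE add_lfunE scale_lfunE.
Qed.

Let hom0_linear : linear hom0.
Proof.
move=> k vW vW'; apply/lfunP => u; rewrite add_lfunE scale_lfunE !hom0E.
by rewrite total_linear (form2_linearl fo) opprD scalerN.
Qed.

Let hom1_linear : linear hom1.
Proof.
move=> k eta eta'; apply/lfunP => w; rewrite add_lfunE scale_lfunE !hom1E.
by rewrite (pairing_linearl (vsval w).1) opprD scalerN.
Qed.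

Let normal_is_complex : is_complex (normal_complex (J := J) (K := K) moment_functor mu p).
Proof.
split.
- move=> k w w'; apply: (congr2 pair); last by rewrite !linearP.
  rewrite -[RHS]/(k *: algebroid_d w + algebroid_d w') !(algebroid_dE aP).
  by rewrite algebroid_vsval_linear linearP opprD scalerN.
- exact: normal_d0_linear.
- move=> w; rewrite -[LHS]/(normal_d0 (normal_dm1 w)) normal_d0E normal_dm1E /=.
  by rewrite algebroid_vecE /= addNr linear0.
Qed.

Let cotangent_is_complex : is_complex (cotangent_complex (J := J) p).
Proof.
split.
- by move=> k x y; rewrite scaler0 addr0.
- exact: dual_d_linear.
- move=> x; apply/lfunP => w; rewrite -[LHS]/(dual_d 0 w) dual_dE.
  by rewrite !zero_lfunE.
Qed.

Let lagrangian_is_cochain_map : is_cochain_map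
  (lagrangian_map (J := J) (K := K) moment_functor mu (omega_can G) om p).
Proof.
split.
- by move=> k x y; rewrite scaler0 addr0.
- exact: hom0_linear.
- exact: hom1_linear.
- move=> w; apply/lfunP => u; rewrite -[LHS]/(hom0 (normal_dm1 w) u) hom0E normal_dm1E /=.
  by rewrite algebroid_vecE /= addNr (form20l fo) oppr0 zero_lfunE.
- move=> vW; apply/lfunP => w; rewrite -[LHS]/(hom1 (normal_d0 vW) w) hom1E normal_d0E.
  rewrite -[RHS]/(dual_d (hom0 vW) w) dual_dE hom0E moment_pairing opprK.
  exact: form2_antisym.
Qed.

(** Degree -1: X |-> (- rho(X), X) is injective.  Degree 0: the kernel of the
    comparison map is v = - rho(W), the image of W; a covector al that vanishes on
    the orbit directions is - om (v, _) for some v, and then dmu v = 0.  Degree 1: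
    eta is mapped to al o rho only if eta = dmu v where al = - om (v, _), and every
    functional on g is a pairing. *)
Lemma moment_lagrangian : quasi_isomorphism
  (lagrangian_map (J := J) (K := K) moment_functor mu (omega_can G) om p).
Proof.
split; [exact: normal_is_complex|exact: cotangent_is_complex|
  exact: lagrangian_is_cochain_map|split].
- split=> [w w0 _|x _]; last first.
    exists 0; last by rewrite /= subr0; exact: thinmx0.
    have z0 : (vsval (0 : subvs_of AJ)).1 = 0 by rewrite linear0.
    apply: (etrans (normal_dm1E 0)); rewrite z0 linear0 oppr0.
    by congr (_, _); apply: algebroid_vec_inj; rewrite algebroid_vecE linear0.
  have := congr1 (fun z => (vsval z.2).1) (etrans (esym (normal_dm1E w)) w0).
  by rewrite /= algebroid_vecE /= => w1; apply: algebroid_vec_inj.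
- split=> [vW _ [z _ zE]|al al0].
    have v0 : vW.1 + inf_action a p (vsval vW.2).1 = 0.
      apply: (symplectic_nondegenerate (ham_symplectic ham) (p := p)) => u.
      have := congr1 (fun h : 'Hom('rV[R]_n, R^o) => h u) zE.
      rewrite [X in X = _]zero_lfunE => /esym h0.
      have h1 := etrans (esym (hom0E vW u)) h0.
      rewrite -[LHS]opprK -[RHS]oppr0; apply: (congr1 -%R).
      exact: h1.
    exists (algebroid_vec a p (vsval vW.2).1) => //.
    apply: (etrans (normal_dm1E _)); rewrite algebroid_vecE /=.
    rewrite [RHS]surjective_pairing; congr (_, _).
      by apply/eqP; rewrite eq_sym -addr_eq0 v0.
    by apply: algebroid_vec_inj; rewrite algebroid_vecE.
  have [v vE] := form2_surjective p (- al) (ham_symplectic ham).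
  have hv u : hom0 (v, 0) u = al u.
    by rewrite hom0E /= linear0 addr0 vE opp_lfunE opprK.
  exists (v, 0); last first.
    exists 0 => //=; apply/lfunP => u.
    by rewrite add_lfunE opp_lfunE [X in _ - X]hv subrr zero_lfunE.
  apply: (etrans (normal_d0E _)); rewrite /= linear0 addr0.
  apply: pairing_inj => X; rewrite pairing0l moment_pairing.
  rewrite (form2_antisym fo) opprK vE opp_lfunE.
  have := congr1 (fun h : 'Hom(_, _) => h (algebroid_vec a p X)) al0.
  rewrite -[X in X = _]/(dual_d al _) dual_dE algebroid_vecE zero_lfunE /= => ->.
  by rewrite oppr0.
split=> [eta _ [al _ alE]|h _].
  have [v vE] := form2_surjective p (- al) (ham_symplectic ham).
  exists (v, 0) => //; apply: (etrans (normal_d0E _)); rewrite /= linear0 addr0.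
  apply: pairing_inj => X; rewrite moment_pairing (form2_antisym fo) opprK vE opp_lfunE.
  have := congr1 (fun h : 'Hom(_, _) => h (algebroid_vec a p X)) alE.
  rewrite -[X in X = _]/(dual_d al _) -[X in _ = X]/(hom1 eta _) dual_dE hom1E.
  by rewrite algebroid_vecE /= => ->; rewrite opprK.
pose eta : 'cV[R]_m := \col_i - h (algebroid_vec a p (delta_mx 0 i)).
have etaE : hom1 eta = h.
  apply/lfunP => w; rewrite hom1E.
  have -> : w = algebroid_vec a p (vsval w).1.
    by apply: algebroid_vec_inj; rewrite algebroid_vecE.
  have hl : linear (fun X => h (algebroid_vec a p X) : R^o).
    by move=> k X X'; rewrite algebroid_vec_linear linearP.
  rewrite algebroid_vecE /= (row_linear_sum _ hl) /pairing mxE -sumrN.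
  by apply: eq_bigr => i _; rewrite mxE mulrN opprK.
exists eta => //; exists 0 => //; apply/lfunP => w.
have d0 : dual_d 0 w = 0 by rewrite dual_dE zero_lfunE.
have h0 : (h - hom1 eta) w = 0 by rewrite etaE subrr zero_lfunE.
exact: etrans d0 (esym h0).
Qed.

End Fibre.
End HamiltonianAction.

Theorem proposition7p8 (R : realType) (m n : nat) (G : lie_group R m)
    (expG : 'rV[R]_m -> G) (M : manifold 'rV[R]_n) (omega : form2 M)
    (a : G -> M -> M) (mu : M -> dual_manifold R m) :
  is_exponential expG -> hamiltonian_action expG omega a mu ->
  shifted_lagrangian (J := action_groupoid a) (K := cotangent_groupoid G)
    (fun z => (z.1, mu z.2)) mu (omega_can G) omega.
Proof.
move=> expGP ham; split.
- exact: action_groupoid_is_lie_groupoid (ham_action ham).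
- exact: cotangent_symplectic_groupoid expGP.
- exact: moment_functor_morphism ham.
- exact: moment_isotropic expGP ham.
- by move=> p; exact: moment_lagrangian expGP ham p.
Qed.
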